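(* Fix a positive integer $n$ and numbers $a_1,a_2,\ldots,a_n>0$. Let $d_1,d_2,\ldots,d_n\geq 5$ be positive integers and let $A\subseteq\mathbb{R}^{d_1}\times\mathbb{R}^{d_2}\times\cdots\times\mathbb{R}^{d_n}$ be a measurable set with $\overline{\delta}(A)>0$. Then there exists $\lambda_0>0$ such that for every real number $\lambda\geq\lambda_0$ the set $A$ contains a box \[ (x_1+k_1s_1,\,x_2+k_2s_2,\,\ldots,\,x_n+k_ns_n),\quad k_1,\ldots,k_n\in\{0,1\}, \] (i.e. all these $2^n$ points belong to $A$) for some $x_j,s_j\in\mathbb{R}^{d_j}$ with $\|s_j\|_{\ell^2}=\lambda a_j$ for $j=1,2,\ldots,n$.
   Context: For a measurable set $A\subseteq\mathbb{R}^d$, its upper Banach density is $\overline{\delta}(A):=\limsup_{N\to\infty}\sup_{x\in\mathbb{R}^d}\frac{|A\cap(x+[0,N]^d)|}{N^d}$, where $|\cdot|$ is Lebesgue measure. Here $\mathbb{R}^{d_1}\times\cdots\times\mathbb{R}^{d_n}$ is identified with $\mathbb{R}^{d_1+\cdots+d_n}$, and $\|v\|_{\ell^2}$ denotes the Euclidean norm. *)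

(* Defs.v *)
From HB Require Import structures.
From mathcomp Require Import all_boot all_order all_algebra.
From mathcomp Require Import all_classical all_reals all_analysis.

Set Implicit Arguments.
Unset Strict Implicit.
Unset Printing Implicit Defensive.

Import Order.TTheory GRing.Theory Num.Theory.
Import numFieldNormedType.Exports.

Local Open Scope classical_set_scope.
Local Open Scope ring_scope.

(* The library norm `|v| on 'rV[R]_m is the sup norm. *)
Definition l2norm (R : realType) (m : nat) (v : 'rV[R]_m) : R :=
  Num.sqrt (\sum_(i < m) v ord0 i ^+ 2).

Definition box (R : realType) (m : nat) (a b : 'rV[R]_m) : set 'rV[R]_m :=
  [set v | forall i, a ord0 i <= v ord0 i <= b ord0 i].

Definition box_volume (R : realType) (m : nat) (a b : 'rV[R]_m) : R :=
  \prod_(i < m) (b ord0 i - a ord0 i).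

(* The covers are indexed by an arbitrary D : set nat, not only by nat, so that
   finite and empty covers are allowed also when m = 0, where every box has
   volume 1. *)
Definition box_cover (R : realType) (m : nat) (X : set 'rV[R]_m)
    (D : set nat) (a b : nat -> 'rV[R]_m) : Prop :=
  (forall k, D k -> forall i, a k ord0 i <= b k ord0 i) /\
  X `<=` \bigcup_(k in D) box (a k) (b k).

(* Lebesgue outer measure on R^m; on the Lebesgue measurable sets, which are
   its Caratheodory measurable sets, it is the (complete) Lebesgue measure. *)
Definition lebesgue_mu (R : realType) (m : nat) (X : set 'rV[R]_m) : \bar R :=
  ereal_inf [set v | exists D a b, box_cover X D a b /\
    v = (\esum_(k in D) (box_volume (a k) (b k))%:E)%E].

Definition lebesgue_measurable (R : realType) (m : nat) (A : set 'rV[R]_m) :=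
  caratheodory_measurable (@lebesgue_mu R m) A.

(* The limit superior is over real N; restricting N to the integers gives the
   same value. *)
Definition upper_banach_density (R : realType) (m : nat) (A : set 'rV[R]_m) :
    \bar R :=
  limf_esup (fun N : R =>
    ereal_sup [set
      (lebesgue_mu (A `&` [set x + y | y in box 0 (const_mx N)])%R *
        (N ^- m)%:E)%E
      | x in [set: 'rV[R]_m]]) +oo%R.

(* Main.v *)
(** Two coordinates of each factor suffice: the side s_j is taken on a short arc
    of the planar circle of radius lambda a_j.  On a fine cyclic grid a box count
    is the average of the products of f over parallelepipeds whose edges follow
    the arcs.  By Cauchy-Schwarz and the equidistribution of the differences of
    points of an arc of radius rho, averaging over it is insensitive to a further
    smoothing at a scale eps rho; call mu the smoothed arc.  If s is a smoothing
    at a scale far below rho and h = s * a one at a scale far above it, then mu is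
    dominated by a multiple of h, and replacing mu by h in one coordinate costs at
    most the quadratic form of s - h, which is nonnegative.  As all these forms
    are monotone in the scale, their contributions telescope along a lacunary
    sequence of radii, so for some radius all replacements are harmless, while the
    count for h is at least the 2^n-th power of the density.  If the theorem
    failed along a sequence of dilations, one could thin it out to a lacunary one
    and apply this to the samples of A on the translates of a grid so fine that
    rounding the arcs to it is not seen by A, up to a small measure. *)

Require Import Defs.
From HB Require Import structures.
From mathcomp Require Import all_boot all_order all_algebra.
From mathcomp Require Import all_classical all_reals all_analysis.
From mathcomp Require Import finmap measurable_realfun.
From mathcomp Require Import ring lra zify.

Set Implicit Arguments.
Unset Strict Implicit.
Unset Printing Implicit Defensive.

Import Order.TTheory GRing.Theory Num.Theory.
Import numFieldNormedType.Exports.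

Local Open Scope classical_set_scope.
Local Open Scope ring_scope.

(** * Weights and quadratic forms on a finite abelian group *)

Section Weights.
Context {R : realType} {G : finZmodType}.
Implicit Types (p q : G -> R) (F : G -> R).

(** The combinatorial core holds on every finite abelian group, with constants depending only on [n]
    and the density. The passage to the continuum needs this uniformity: the constants fix how many
    radii are used, the radii fix the cube on which [A] is sampled, that cube fixes how small the
    rounding error must be, and only then is the mesh, hence the group, chosen. The cancellation
    usually taken from the Fourier decay of the circle is obtained by hand: on an arc short compared
    with its radius the second differences of the height are all close to [1 / rho], so the
    displacements between points at a fixed vertical distance grow by nearly constant steps. The
    forms are monotone because the coarse smoothings are autoconvolutions, whose form is the mean
    square of a smoothed function. The domination constant may be huge and enters to the power [n];
    this is harmless because the number of radii is chosen after it. *)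

Definition mean F : R := (\sum_x F x) / #|G|%:R.

Definition expect p F : R := \sum_x p x * F x.

Definition nonneg p := forall x, 0 <= p x.

Definition prob p := nonneg p /\ \sum_x p x = 1.

Definition conv p q : G -> R := fun x => \sum_y p y * q (x - y).

Definition refl p : G -> R := fun x => p (- x).

Definition unif (I : finType) (s : I -> G) : G -> R :=
  fun x => (\sum_i (s i == x)%:R) / #|I|%:R.

Definition dirac0 : G -> R := fun x => (x == 0)%:R.

Lemma cardG_gt0 : 0 < #|G|%:R :> R.
Proof. by rewrite ltr0n; apply/card_gt0P; exists 0. Qed.

Lemma meanD F F' : mean (fun x => F x + F' x) = mean F + mean F'.
Proof. by rewrite /mean big_split /= mulrDl. Qed.

Lemma meanZ c F : mean (fun x => c * F x) = c * mean F.
Proof. by rewrite /mean -mulr_sumr mulrA. Qed.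

Lemma meanB F F' : mean (fun x => F x - F' x) = mean F - mean F'.
Proof. by rewrite /mean sumrB mulrBl. Qed.

Lemma mean_sum (I : Type) (r : seq I) (F : I -> G -> R) :
  mean (fun x => \sum_(i <- r) F i x) = \sum_(i <- r) mean (F i).
Proof. by rewrite /mean exchange_big /= mulr_suml. Qed.

Lemma eq_mean F F' : F =1 F' -> mean F = mean F'.
Proof. by move=> e; rewrite /mean (eq_bigr F'). Qed.

Lemma mean_shift F s : mean (fun x => F (x + s)) = mean F.
Proof.
rewrite /mean; congr (_ / _); symmetry.
by rewrite (reindex_inj (addIr s)).
Qed.

Lemma le_mean F F' : (forall x, F x <= F' x) -> mean F <= mean F'.
Proof.
move=> h; rewrite /mean ler_pM2r ?invr_gt0 ?cardG_gt0//.
by apply: ler_sum => x _; exact: h.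
Qed.

Lemma mean_cst c : mean (fun=> c) = c.
Proof.
rewrite /mean sumr_const -[_ *+ _]mulr_natr mulfK//.
by rewrite gt_eqF// cardG_gt0.
Qed.

Lemma mean_ge0 F : nonneg F -> 0 <= mean F.
Proof. by move=> h; rewrite -(mean_cst 0); apply: le_mean. Qed.

Lemma normr_mean F : `|mean F| <= mean (fun x => `|F x|).
Proof.
rewrite /mean normrM normfV normr_nat ler_pM2r ?invr_gt0 ?cardG_gt0//.
exact: ler_norm_sum.
Qed.

Lemma eq_expect p F F' : F =1 F' -> expect p F = expect p F'.
Proof. by move=> e; apply: eq_bigr => x _; rewrite e. Qed.

Lemma expectD p F F' :
  expect p (fun x => F x + F' x) = expect p F + expect p F'.
Proof. by rewrite -big_split; apply: eq_bigr => x _; rewrite mulrDr. Qed.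

Lemma expectB p F F' :
  expect p (fun x => F x - F' x) = expect p F - expect p F'.
Proof. by rewrite -sumrB; apply: eq_bigr => x _; rewrite mulrBr. Qed.

Lemma expectZ p c F : expect p (fun x => c * F x) = c * expect p F.
Proof. by rewrite mulr_sumr; apply: eq_bigr => x _; rewrite mulrCA. Qed.

Lemma expect_cst p c : prob p -> expect p (fun=> c) = c.
Proof. by case=> _ p1; rewrite /expect -mulr_suml p1 mul1r. Qed.

Lemma le_expect p F F' : nonneg p -> (forall x, p x != 0 -> F x <= F' x) ->
  expect p F <= expect p F'.
Proof.
move=> p0 h; apply: ler_sum => x _.
have [->|px] := eqVneq (p x) 0; first by rewrite !mul0r.
by rewrite ler_wpM2l// h.
Qed.

Lemma expect_ge0 p F : nonneg p -> nonneg F -> 0 <= expect p F.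
Proof. by move=> p0 F0; apply: sumr_ge0 => x _; rewrite mulr_ge0. Qed.

Lemma normr_expect_le p F c : prob p -> (forall x, p x != 0 -> `|F x| <= c) ->
  `|expect p F| <= c.
Proof.
move=> pp h; rewrite ler_norml; apply/andP; split.
  rewrite -(expect_cst (- c) pp); apply: le_expect pp.1 _ => x /h.
  by rewrite ler_norml => /andP[].
rewrite -[leRHS](expect_cst c pp); apply: le_expect pp.1 _ => x /h.
by rewrite ler_norml => /andP[].
Qed.

Lemma expect_swap p q (F : G -> G -> R) :
  expect p (fun x => expect q (F x)) =
  expect q (fun y => expect p (fun x => F x y)).
Proof.
rewrite /expect; under eq_bigr do rewrite mulr_sumr.
rewrite exchange_big; apply: eq_bigr => y _; rewrite mulr_sumr.
by apply: eq_bigr => x _; rewrite mulrCA.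
Qed.

Lemma expect_mean p (F : G -> G -> R) :
  expect p (fun s => mean (F s)) = mean (fun x => expect p (fun s => F s x)).
Proof.
rewrite mean_sum; apply: eq_bigr => s _; by rewrite meanZ.
Qed.

Lemma expect_conv p q F :
  expect (conv p q) F = expect p (fun x => expect q (fun y => F (x + y))).
Proof.
rewrite /expect /conv; under eq_bigr do rewrite mulr_suml.
rewrite exchange_big; apply: eq_bigr => x _; rewrite mulr_sumr.
rewrite (reindex_inj (addIr x)); apply: eq_bigr => y _.
by rewrite addrK [y + x]addrC mulrA.
Qed.

Lemma expect_refl p F : expect (refl p) F = expect p (fun x => F (- x)).
Proof.
rewrite /expect (reindex_inj oppr_inj).
by apply: eq_bigr => x _; rewrite /refl opprK.
Qed.

Lemma expect_unif (I : finType) (s : I -> G) F :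
  expect (unif s) F = (\sum_i F (s i)) / #|I|%:R.
Proof.
rewrite /expect /unif; under eq_bigr do rewrite mulrAC mulr_suml.
rewrite -mulr_suml exchange_big; congr (_ / _); apply: eq_bigr => i _.
rewrite (bigD1 (s i))//= eqxx mul1r big1 ?addr0// => x /negPf.
by rewrite eq_sym => ->; rewrite mul0r.
Qed.

Lemma expect_dirac0 F : expect dirac0 F = F 0.
Proof.
rewrite /expect /dirac0 (bigD1 0)//= eqxx mul1r big1 ?addr0// => x /negPf ->.
by rewrite mul0r.
Qed.

Lemma sum_expect1 p : \sum_x p x = expect p (fun=> 1).
Proof. by apply: eq_bigr => x _; rewrite mulr1. Qed.

Lemma prob_conv p q : prob p -> prob q -> prob (conv p q).
Proof.
move=> pp pq; split; first by move=> x; apply: sumr_ge0 => y _; rewrite mulr_ge0 ?pp.1 ?pq.1.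
rewrite sum_expect1 expect_conv -[RHS](expect_cst 1 pp).
by apply: eq_expect => x; rewrite expect_cst.
Qed.

Lemma prob_refl p : prob p -> prob (refl p).
Proof.
move=> pp; split; first by move=> x; rewrite /refl pp.1.
by rewrite sum_expect1 expect_refl expect_cst.
Qed.

Lemma prob_unif (I : finType) (s : I -> G) : (0 < #|I|)%N -> prob (unif s).
Proof.
move=> I0; split.
  by move=> x; rewrite divr_ge0 ?ler0n// sumr_ge0// => i _; rewrite ler0n.
rewrite sum_expect1 expect_unif sumr_const divff//.
by rewrite pnatr_eq0 -lt0n.
Qed.

Lemma prob_dirac0 : prob dirac0.
Proof.
split; first by move=> x; rewrite ler0n.
by rewrite sum_expect1 expect_dirac0.
Qed.

Lemma conv_neq0 p q x : conv p q x != 0 ->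
  exists y z, [/\ p y != 0, q z != 0 & x = y + z].
Proof.
move=> h; have [y py] : exists y, p y * q (x - y) != 0.
  apply/existsP; apply: contraNT h => /existsPn h.
  by apply/eqP; apply: big1 => y _; apply/eqP; move: (h y); rewrite negbK.
exists y, (x - y); move: py; rewrite mulf_eq0 negb_or => /andP[-> ->].
by rewrite addrC subrK.
Qed.

Lemma unif_neq0 (I : finType) (s : I -> G) x : unif s x != 0 ->
  exists i, x = s i.
Proof.
move=> h; suff /existsP[i /eqP <-] : [exists i, s i == x] by exists i.
apply: contraNT h => /existsPn h; rewrite /unif big1 ?mul0r// => i _.
by rewrite (negPf (h i)).
Qed.

Lemma cauchy_mean F F' :
  (mean (fun x => F x * F' x)) ^+ 2 <=
  mean (fun x => F x ^+ 2) * mean (fun x => F' x ^+ 2).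
Proof.
set a := mean (fun x => F x ^+ 2); set b := mean (fun x => F' x ^+ 2).
set c := mean _.
have a0 : 0 <= a by apply: mean_ge0 => x; rewrite sqr_ge0.
have b0 : 0 <= b by apply: mean_ge0 => x; rewrite sqr_ge0.
have h t s : 0 <= t ^+ 2 * a + 2 * t * s * c + s ^+ 2 * b.
  have -> : t ^+ 2 * a + 2 * t * s * c + s ^+ 2 * b =
      mean (fun x => (t * F x + s * F' x) ^+ 2).
    by rewrite -!meanZ -!meanD; apply: eq_mean => x; ring.
  by apply: mean_ge0 => x; rewrite sqr_ge0.
have [a00|a_neq0] := eqVneq a 0.
  have [b00|b_neq0] := eqVneq b 0.
    have := h 1 1; have := h 1 (-1); rewrite a00 b00 => h1 h2.
    have -> : c = 0 by lra.
    by rewrite mul0r expr0n.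
  (* With [a = 0], the choice [t = -(1 + b)], [s = c] turns nonnegativity into
     [0 <= - c ^+ 2 * (2 + b)]. *)
  have := h (- (1 + b)) (c); rewrite a00 => h1.
  have : c ^+ 2 * (2 + b) <= 0 by nra.
  rewrite pmulr_lle0//; lra.
have a_gt0 : 0 < a by rewrite lt_neqAle eq_sym a_neq0.
have := h (- c) a => h1.
have : 0 <= a * (a * b - c ^+ 2) by nra.
by rewrite pmulr_rge0// subr_ge0.
Qed.

Lemma cauchy_expect p F : prob p -> (expect p F) ^+ 2 <= expect p (fun x => F x ^+ 2).
Proof.
move=> pp; set m := expect p F.
have : 0 <= expect p (fun x => (F x - m) ^+ 2).
  by apply: expect_ge0 pp.1 _ => x; rewrite sqr_ge0.
have -> : expect p (fun x => (F x - m) ^+ 2) =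
    expect p (fun x => F x ^+ 2) - 2 * m * expect p F + m ^+ 2.
  rewrite -[m ^+ 2 in RHS](expect_cst _ pp) -expectZ -expectB -expectD.
  by apply: eq_expect => x; ring.
by rewrite -/m => h; nra.
Qed.

Lemma sqr_mean_le F : (mean F) ^+ 2 <= mean (fun x => F x ^+ 2).
Proof.
have := cauchy_mean (fun=> 1) F; rewrite expr1n mean_cst mul1r.
by under eq_mean do rewrite mul1r.
Qed.

Definition corr F s : R := mean (fun x => F x * F (x + s)).

Definition qform p F : R := expect p (corr F).

Lemma corrN F s : corr F (- s) = corr F s.
Proof.
rewrite /corr -(mean_shift (fun x => F x * F (x - s)) s).
by apply: eq_mean => x; rewrite addrK mulrC.
Qed.

Lemma corr0 F : corr F 0 = mean (fun x => F x ^+ 2).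
Proof. by apply: eq_mean => x; rewrite addr0. Qed.

Definition unitval F := forall x, 0 <= F x <= 1.

Lemma unitval_shiftM F s : unitval F -> unitval (fun x => F x * F (x + s)).
Proof.
move=> h x; have /andP[a b] := h x; have /andP[c d] := h (x + s).
by rewrite mulr_ge0//= mulr_ile1.
Qed.

Lemma unitval_expect p F : prob p -> unitval F ->
  unitval (fun x => expect p (fun y => F (x + y))).
Proof.
move=> pp h x; apply/andP; split.
  by apply: expect_ge0 pp.1 _ => y; case/andP: (h (x + y)).
rewrite -[leRHS](expect_cst 1 pp); apply: le_expect pp.1 _ => y _.
by case/andP: (h (x + y)).
Qed.

Lemma unitval_mean F : unitval F -> 0 <= mean F <= 1.
Proof.
move=> h; apply/andP; split.
  by apply: mean_ge0 => x; case/andP: (h x).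
by rewrite -[leRHS](mean_cst 1); apply: le_mean => x; case/andP: (h x).
Qed.

Lemma unitval_corr F : unitval F -> unitval (corr F).
Proof. by move=> h s; apply: unitval_mean; exact: unitval_shiftM. Qed.

Lemma corr_diff F w s : corr (fun x => F x - F (x + w)) s =
    2 * corr F s - corr F (s + w) - corr F (s - w).
Proof.
have -> : 2 * corr F s - corr F (s + w) - corr F (s - w) =
     corr F s + mean (fun x => F (x + w) * F (x + w + s)) - corr F (s + w)
     - mean (fun x => F (x + w) * F (x + w + (s - w))).
  rewrite (mean_shift (fun x => F x * F (x + s)) w).
  by rewrite (mean_shift (fun x => F x * F (x + (s - w))) w) /corr; ring.
rewrite /corr -!meanD -!meanB; apply: eq_mean => x.
have -> : x + w + (s - w) = x + s by rewrite addrACA subrr addr0.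
have -> : x + w + s = x + (s + w) by rewrite addrAC addrA.
have -> : x + s + w = x + (s + w) by rewrite addrA.
by ring.
Qed.

(** Both sides are values of one autocorrelation, that of [D x = F x - F (x + w)]: the left side at
    [v], the right side at 0, where it is largest in absolute value. *)
Lemma corr_second_diff F v w :
  `|2 * corr F v - corr F (v + w) - corr F (v - w)| <= 2 * corr F 0 - 2 * corr F w.
Proof.
pose D x := F x - F (x + w).
have e s : mean (fun x => D x * D (x + s)) =
  2 * corr F s - corr F (s + w) - corr F (s - w) by exact: corr_diff.
rewrite -e; apply: (le_trans (normr_mean _)).
have -> : 2 * corr F 0 - 2 * corr F w = mean (fun x => D x * D (x + 0)).
  by rewrite e add0r sub0r corrN; ring.
have -> : mean (fun x => D x * D (x + 0)) =
    mean (fun x => 2^-1 * (D x ^+ 2 + D (x + v) ^+ 2)).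
  rewrite meanZ meanD (mean_shift (fun x => D x ^+ 2)).
  rewrite (@eq_mean _ (fun x => D x ^+ 2)) => [|x]; last by rewrite addr0.
  by field.
apply: le_mean => x; rewrite normrM.
have := sqr_ge0 (`|D x| - `|D (x + v)|).
rewrite -[D x ^+ 2]real_normK ?num_real// -[D (x + v) ^+ 2]real_normK ?num_real//.
lra.
Qed.

Lemma corr_le0 F w : corr F w <= corr F 0.
Proof.
have := corr_second_diff F w w.
have := le_trans (normr_ge0 _) (corr_second_diff F 0 w).
lra.
Qed.

Lemma corr_expect c F w :
  corr (fun x => expect c (fun u => F (x + u))) w =
  expect c (fun v => expect c (fun u => corr F (v - u + w))).
Proof.
have e u v : corr F (v - u + w) = mean (fun x => F (x + u) * F (x + w + v)).
  rewrite /corr -(mean_shift (fun x => F x * F (x + (v - u + w))) u).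
  apply: eq_mean => x; congr (_ * F _).
  rewrite -(addrA x u) -(addrA x w); congr (x + _).
  by rewrite addrA (addrC u) subrK addrC.
under eq_expect do under eq_expect do rewrite e.
under eq_expect do rewrite expect_mean.
rewrite expect_mean; apply: eq_mean => x.
under [in RHS]eq_expect => v do under eq_expect => u do rewrite mulrC.
under [in RHS]eq_expect => v do rewrite expectZ mulrC.
by rewrite expectZ.
Qed.

(** In Fourier terms the factor [|c^|^2] moves from the weight to the function. This reduces a form
    at a coarse scale to one at a single scale applied to a smoothed function. *)
Lemma qform_autoconv c q F :
  qform (conv (conv c (refl c)) q) F =
  qform q (fun x => expect c (fun u => F (x + u))).
Proof.
rewrite /qform !expect_conv.
under eq_expect => v do rewrite expect_refl.
under [RHS]eq_expect => w do rewrite corr_expect.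
rewrite [RHS]expect_swap; apply: eq_expect => v.
by rewrite [RHS]expect_swap.
Qed.

Lemma qform_le0 p F : prob p -> qform p F <= qform dirac0 F.
Proof.
move=> pp; rewrite /qform expect_dirac0 -(expect_cst (corr F 0) pp).
by apply: le_expect pp.1 _ => x _; exact: corr_le0.
Qed.

(** Once [c] is absorbed into [F], the law [q] competes with the Dirac mass at 0, the maximum of the
    autocorrelation. Hence a further smoothing only decreases the form. *)
Lemma qform_autoconv_le c q F : prob q ->
  qform (conv (conv c (refl c)) q) F <= qform (conv c (refl c)) F.
Proof.
move=> pq; rewrite qform_autoconv (le_trans (qform_le0 _ pq))//.
rewrite -qform_autoconv /qform !expect_conv.
rewrite le_eqVlt; apply/orP; left; apply/eqP; apply: eq_expect => x; apply: eq_expect => y.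
by rewrite expect_dirac0 addr0.
Qed.

(** The form is the mean square of the smoothed function, which has the same mean as [F]. *)
Lemma qform_autoconv_ge c F : prob c ->
  (mean F) ^+ 2 <= qform (conv c (refl c)) F.
Proof.
move=> pc.
have -> : qform (conv c (refl c)) F = mean (fun x => expect c (fun u => F (x + u)) ^+ 2).
  rewrite -corr0 corr_expect /qform expect_conv; apply: eq_expect => v.
  by rewrite expect_refl; apply: eq_expect => u; rewrite addr0.
apply: le_trans (sqr_mean_le _).
by rewrite -expect_mean; under eq_expect do rewrite mean_shift; rewrite expect_cst.
Qed.

End Weights.

(** * Equidistribution of rounded sequences and arcs *)

Section Riemann.
Context {R : realType}.
Implicit Types (c : nat -> R) (t v : R).

(** For [v >= 0], [ramp (v - i)] is the length of the part of the cell from [i] to [i + 1] lying in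
    [0, v]. So the sums of [ramp (v - i) * c i] below are integrals from 0 to [v] of the step
    function with values [c i]. *)
Definition ramp t : R := Num.min 1 (Num.max 0 t).

Lemma ramp_itv t : 0 <= ramp t <= 1.
Proof. by rewrite /ramp ge_min lexx le_min ler01 le_max lexx. Qed.

Lemma ramp_le0 t : t <= 0 -> ramp t = 0.
Proof. by move=> t0; rewrite /ramp (max_idPl t0) (min_idPr ler01). Qed.

Lemma ramp_ge1 t : 1 <= t -> ramp t = 1.
Proof.
move=> t1; rewrite /ramp (max_idPr _) ?(le_trans ler01)//.
exact: (min_idPl t1).
Qed.

Lemma ramp_id t : 0 <= t <= 1 -> ramp t = t.
Proof.
by move=> /andP[t0 t1]; rewrite /ramp (max_idPr t0); exact: (min_idPr t1).
Qed.

Lemma le_ramp t t' : t <= t' -> ramp t <= ramp t'.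
Proof.
move=> h; have [t0|t0] := lerP t 0; first by rewrite ramp_le0//; case/andP: (ramp_itv t').
have [t1|t1] := lerP 1 t'; first by rewrite [ramp t']ramp_ge1//; case/andP: (ramp_itv t).
by rewrite !ramp_id//; lra.
Qed.

Lemma sum_ramp N v : 0 <= v -> v <= N%:R -> \sum_(i < N) ramp (v - i%:R) = v.
Proof.
elim: N v => [|N IH] v v0 vN; first by rewrite big_ord0; apply/eqP; rewrite eq_le v0 vN.
rewrite big_ord_recr/=; have [h|h] := lerP v N%:R.
  by rewrite IH// ramp_le0 ?addr0// subr_le0.
rewrite ramp_id; last by rewrite -natr1 in vN; lra.
rewrite (eq_bigr (fun i : 'I_N => ramp (N%:R - i%:R))); first by rewrite IH//; lra.
move=> i _; have : i.+1%:R <= N%:R :> R by rewrite ler_nat.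
by rewrite -natr1 => iN; rewrite !ramp_ge1//; lra.
Qed.

Lemma lip_nat c l : (forall i, `|c i.+1 - c i| <= l) ->
  forall i j, `|c i - c j| <= l * `|i%:R - j%:R|.
Proof.
move=> h; suff H i k : `|c (i + k)%N - c i| <= l * k%:R.
  move=> i j; have [ij|/ltnW ij] := leqP i j.
    rewrite distrC [ `|i%:R - _|]distrC -(subnKC ij) natrD [i%:R + _]addrC addrK.
    by rewrite normr_nat; exact: H.
  by rewrite -(subnKC ij) natrD [j%:R + _]addrC addrK normr_nat; exact: H.
elim: k => [|k IH]; first by rewrite addn0 subrr normr0 mulr0.
rewrite addnS -natr1 mulrDr mulr1 -(subrKA (c (i + k)%N)).
by rewrite (le_trans (ler_normD _ _))// addrC lerD.
Qed.

Lemma ramp_sum_lip c N v v' : (forall i, `|c i| <= 1) ->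
  0 <= v -> v <= v' -> v' <= N%:R ->
  `|\sum_(i < N) ramp (v' - i%:R) * c i - \sum_(i < N) ramp (v - i%:R) * c i|
    <= v' - v.
Proof.
move=> c1 v0 vv' v'N.
rewrite -sumrB (le_trans (ler_norm_sum _ _ _))//.
rewrite -{2}(@sum_ramp N v)// ?(le_trans vv')// -{2}(@sum_ramp N v')// ?(le_trans v0)//.
rewrite -sumrB ler_sum// => i _; rewrite -mulrBl normrM.
have h : 0 <= ramp (v' - i%:R) - ramp (v - i%:R) by rewrite subr_ge0 le_ramp// lerD2r.
by rewrite ger0_norm// ler_piMr.
Qed.

(** Only the cells meeting [v, v'] carry weight; their indices are within 2 of [n], where [c]
    changes by at most [2 * l]. *)
Lemma riemann_step c l N v v' (n : nat) :
  (forall i, `|c i.+1 - c i| <= l) ->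
  0 <= v -> v <= v' -> v' <= v + 1 -> v' <= N%:R -> `|n%:R - v| <= 1 ->
  `|\sum_(i < N) ramp (v' - i%:R) * c i - \sum_(i < N) ramp (v - i%:R) * c i
    - (v' - v) * c n| <= 2 * l * (v' - v).
Proof.
move=> cl v0 vv' v'v v'N nv.
have l0 : 0 <= l by apply: le_trans (cl 0%N).
pose r i := ramp (v' - i%:R) - ramp (v - i%:R).
have r0 i : 0 <= r i by rewrite subr_ge0 le_ramp// lerD2r.
have sr : \sum_(i < N) r i = v' - v.
  by rewrite sumrB !sum_ramp// ?(le_trans v0)// (le_trans vv').
rewrite -sr -sumrB mulr_suml -sumrB mulr_sumr (le_trans (ler_norm_sum _ _ _))//.
apply: ler_sum => i _.
have -> : ramp (v' - i%:R) * c i - ramp (v - i%:R) * c i - r i * c n =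
   r i * (c i - c n) by rewrite /r; ring.
rewrite normrM ger0_norm// mulrC.
have [h1|h1] := lerP (i%:R + 1) v.
  by rewrite /r !ramp_ge1 ?subrr ?mulr0//; lra.
have [h2|h2] := lerP v' i%:R.
  by rewrite /r !ramp_le0 ?subrr ?mulr0//; lra.
rewrite ler_wpM2r// (le_trans (lip_nat cl i n))// mulrC ler_wpM2r//.
by move: nv; rewrite !ler_norml => /andP[? ?]; apply/andP; split; lra.
Qed.

(* If the steps of v are nearly constant, the rounded sequence n is nearly
   equidistributed at unit scale, hence averages along it are nearly invariant
   under integer shifts. *)
Lemma shift_sum c l D g (v : nat -> R) (n : nat -> nat) (m w : nat) :
  (forall i, `|c i| <= 1) -> (forall i, `|c i.+1 - c i| <= l) ->
  0 < D -> 0 <= g -> (1 + g) * D <= 1 -> 0 <= v 0%N ->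
  (forall y, (y < m)%N -> D <= v y.+1 - v y <= (1 + g) * D) ->
  (forall y, (y < m)%N -> `|(n y)%:R - v y| <= 1) ->
  `|\sum_(y < m) (c (n y + w)%N - c (n y))| <=
    2 * g * m%:R + 2 * w%:R / D + 4 * l * (1 + g) * m%:R.
Proof.
move=> c1 cl D0 g0 D1 v0 hv hn.
have l0 : 0 <= l by apply: le_trans (cl 0%N).
have vge y : (y <= m)%N -> 0 <= v y <= v m.
  move=> ym; apply/andP; split.
    elim: y ym => // y IH ym; have /andP[] := hv y ym.
    by have := IH (ltnW ym); lra.
  have -> : m = (y + (m - y))%N by rewrite subnKC.
  have := leqnn (m - y)%N; elim: {-2}(m - y)%N => [|k IH] hk; first by rewrite addn0.
  have /andP[] := hv (y + k)%N ltac:(lia); rewrite addnS.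
  by have := IH (ltnW hk); lra.
have [N hN] : exists N : nat, v m + w%:R <= N%:R.
  by exists (Num.trunc (v m + w%:R)).+1; rewrite ltW// truncnS_gt.
(* [P] is the primitive of the step function [c]. The sums of [c (n y + s)] weighted by the steps of
   [v] are Riemann sums for the window from [v 0 + s] to [v m + s]. The windows for [s = w] and
   [s = 0] differ by two pieces of length [w], and near constancy of the steps removes the
   weights. *)
pose P t := \sum_(i < N) ramp (t - i%:R) * c i.
have w0 : 0 <= w%:R :> R by rewrite ler0n.
have step (s y : nat) : (s <= w)%N -> (y < m)%N ->
  `|P (v y.+1 + s%:R) - P (v y + s%:R) - (v y.+1 - v y) * c (n y + s)%N|
    <= 2 * l * ((1 + g) * D).
  move=> sw ym; have /andP[h1 h2] := hv y ym.
  have s0 : 0 <= s%:R :> R by rewrite ler0n.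
  have sw' : s%:R <= w%:R :> R by rewrite ler_nat.
  have /andP[h3 h4] := vge y (ltnW ym); have /andP[h5 h6] := vge y.+1 ym.
  have e : v y.+1 - v y = (v y.+1 + s%:R) - (v y + s%:R) by ring.
  rewrite {1}e; apply: le_trans (riemann_step _ _ _ _ _ _) _ => //.
  - lra.
  - lra.
  - lra.
  - lra.
  - by rewrite natrD opprD addrACA subrr addr0; exact: hn.
  by rewrite -e ler_wpM2l//; lra.
have tot (s : nat) : (s <= w)%N ->
  `|P (v m + s%:R) - P (v 0%N + s%:R) -
    \sum_(y < m) (v y.+1 - v y) * c (n y + s)%N| <= 2 * l * ((1 + g) * D) * m%:R.
  move=> sw.
  have -> : P (v m + s%:R) - P (v 0%N + s%:R) =
      \sum_(y < m) (P (v y.+1 + s%:R) - P (v y + s%:R)).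
    by rewrite -(big_mkord xpredT (fun y => P (v y.+1 + s%:R) - P (v y + s%:R)))
      telescope_sumr.
  rewrite -sumrB (le_trans (ler_norm_sum _ _ _))//.
  apply: (le_trans (ler_sum _ (G := fun=> 2 * l * ((1 + g) * D)) _)).
    by move=> y _; exact: step.
  by rewrite sumr_const card_ord -[_ *+ m]mulr_natr.
have Pw t : 0 <= t -> t <= v m -> `|P (t + w%:R) - P t| <= w%:R.
  move=> t0 tm; rewrite -[leRHS](addrK t) [w%:R + t]addrC.
  by apply: ramp_sum_lip => //; lra.
pose S := \sum_(y < m) (c (n y + w)%N - c (n y)).
pose S' := \sum_(y < m) (v y.+1 - v y) * (c (n y + w)%N - c (n y)).
have h1 : `|S' - D * S| <= g * D * 2 * m%:R.
  rewrite mulr_sumr -sumrB (le_trans (ler_norm_sum _ _ _))//.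
  apply: (le_trans (ler_sum _ (G := fun=> g * D * 2) _)).
    move=> y _; rewrite -mulrBl normrM ler_pM//.
      have /andP[? ?] := hv y (ltn_ord y).
      by rewrite ger0_norm; lra.
    by rewrite (le_trans (ler_normB _ _))// (_ : 2 = 1 + 1)// lerD.
  by rewrite sumr_const card_ord -[_ *+ m]mulr_natr.
have h2 : `|S'| <= 2 * w%:R + 4 * l * ((1 + g) * D) * m%:R.
  have := tot w (leqnn w); have := tot 0%N (leq0n w); rewrite !addr0.
  have := Pw (v m); have := Pw (v 0%N).
  have /andP[a1 a2] := vge 0%N (leq0n m); have /andP[a3 a4] := vge m (leqnn m).
  move=> /(_ a1 a2) b1 /(_ a3 a4) b2.
  have -> : S' = \sum_(y < m) (v y.+1 - v y) * c (n y + w)%N -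
      \sum_(y < m) (v y.+1 - v y) * c (n y + 0)%N.
    by rewrite -sumrB; apply: eq_bigr => y _; rewrite mulrBr addn0.
  move: b1 b2; rewrite !ler_norml => /andP[? ?] /andP[? ?] /andP[? ?] /andP[? ?].
  by apply/andP; split; lra.
have h3 : D * `|S| <= g * D * 2 * m%:R + 2 * w%:R + 4 * l * ((1 + g) * D) * m%:R.
  rewrite -{1}(gtr0_norm D0) -normrM.
  rewrite -[D * S](subKr S') (le_trans (ler_normB _ _))//; lra.
have -> : 2 * g * m%:R + 2 * w%:R / D + 4 * l * (1 + g) * m%:R =
  D^-1 * (g * D * 2 * m%:R + 2 * w%:R + 4 * l * ((1 + g) * D) * m%:R).
  by field; rewrite gt_eqF.
by rewrite -(ler_pM2l D0) (mulrA D D^-1) mulfV ?mul1r// gt_eqF.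
Qed.

Definition arc_height (rho : R) (y : nat) : R := Num.sqrt (rho ^+ 2 - y%:R ^+ 2).

Lemma arc_ge0 rho y : 0 <= arc_height rho y.
Proof. exact: sqrtr_ge0. Qed.

Lemma sqr_arc rho (y : nat) : y%:R <= rho -> arc_height rho y ^+ 2 = rho ^+ 2 - y%:R ^+ 2.
Proof.
move=> h; rewrite sqr_sqrtr// subr_ge0 lerXn2r// nnegrE ?ler0n//.
by rewrite (le_trans _ h).
Qed.

Lemma arc_le rho y : 0 <= rho -> arc_height rho y <= rho.
Proof.
move=> r0; rewrite -[leRHS]ger0_norm// -sqrtr_sqr.
by rewrite ler_wsqrtr// gerBl sqr_ge0.
Qed.

Lemma le_arc rho y y' : (y <= y')%N -> arc_height rho y' <= arc_height rho y.
Proof.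
by move=> h; rewrite ler_wsqrtr// lerD2l lerN2 lerXn2r ?nnegrE ?ler0n// ler_nat.
Qed.

Lemma arc_ge rho b y : 0 < rho -> 0 < b -> b <= 1 -> y%:R <= b * rho ->
  (1 - b ^+ 2) * rho <= arc_height rho y.
Proof.
move=> r0 b0 b1 h.
have b2 : b ^+ 2 <= 1 by rewrite expr_le1// ltW.
have e0 : 0 <= (1 - b ^+ 2) * rho by rewrite mulr_ge0 ?subr_ge0// ltW.
rewrite -[leLHS]ger0_norm// -sqrtr_sqr ler_wsqrtr//.
have : y%:R ^+ 2 <= (b * rho) ^+ 2 by rewrite lerXn2r// nnegrE ?ler0n// mulr_ge0// ltW.
rewrite !exprMn => h2.
suff : (1 - b ^+ 2) ^+ 2 * rho ^+ 2 <= (1 - b ^+ 2) * rho ^+ 2 by lra.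
rewrite ler_wpM2r ?sqr_ge0// expr2 ler_piMr ?subr_ge0// gerBl sqr_ge0//.
Qed.

(** The squares of consecutive heights differ by consecutive odd numbers. Subtracting the two
    factored differences gives the identity [key] for the second difference [v - u], in which
    [B + C] lies between [2 * (1 - b ^+ 2) * rho] and [2 * rho] and [u <= v] are of order [b]. *)
Lemma arc_second_diff rho b y : 0 < rho -> 0 < b -> b <= 2^-1 ->
  y.+2%:R <= b * rho ->
  rho^-1 <= 2 * arc_height rho y.+1 - arc_height rho y - arc_height rho y.+2 <= (1 + 4 * b ^+ 2) / rho.
Proof.
move=> r0 b0 b1 h.
have br : b * rho <= rho by rewrite ler_piMl//; lra.
have y1 : y.+1%:R <= b * rho by apply: le_trans h; rewrite ler_nat.
have y0 : y%:R <= b * rho by apply: le_trans h; rewrite ler_nat; lia.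
have b1' : b <= 1 by lra.
have Ag := arc_ge r0 b0 b1' y0; have Bg := arc_ge r0 b0 b1' y1.
have Cg := arc_ge r0 b0 b1' h.
have A2 := sqr_arc (le_trans y0 br); have B2 := sqr_arc (le_trans y1 br).
have C2 := sqr_arc (le_trans h br).
have AB := le_arc rho (leqnSn y); have BC := le_arc rho (leqnSn y.+1).
have Al := arc_le y (ltW r0); have Bl := arc_le y.+1 (ltW r0).
move: (arc_height rho y) (arc_height rho y.+1) (arc_height rho y.+2) Ag Bg Cg A2 B2 C2 AB BC Al Bl.
move=> A B C Ag Bg Cg A2 B2 C2 AB BC Al Bl.
rewrite -!natr1 in h A2 B2 C2; set p : R := y%:R in h A2 B2 C2.
have p0 : 0 <= p by rewrite ler0n.
pose u := A - B; pose v := B - C.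
have key : (v - u) * (B + C) = 2 + u * (u + v) by rewrite /u /v; nra.
have u0 : 0 <= u by rewrite /u; lra.
have v0 : 0 <= v by rewrite /v; lra.
have x1 : b ^+ 2 <= 4^-1 by nra.
have x0 : 0 < b ^+ 2 by rewrite exprn_gt0.
have -> : 2 * B - A - C = v - u by rewrite /u /v; ring.
have BC0 : 0 < B + C by nra.
have vu : 0 <= v - u by nra.
have vb : v <= b / (1 - b ^+ 2).
  rewrite ler_pdivlMr; last by lra.
  have : v * (B + C) = 2 * p + 3 by rewrite /v; nra.
  move=> e1; have e2 : v * (2 * (1 - b ^+ 2) * rho) <= 2 * (b * rho).
    apply: (@le_trans _ _ (v * (B + C))); first by rewrite ler_wpM2l//; lra.
    by rewrite e1; lra.
  rewrite -(ler_pM2r r0); lra.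
have vb2 : v ^+ 2 <= 16 / 9 * b ^+ 2.
  have : v <= 4 / 3 * b.
    apply: (le_trans vb); rewrite ler_pdivrMr; last by lra.
    nra.
  by move=> h4; nra.
apply/andP; split.
  by rewrite -div1r ler_pdivrMr//; nra.
rewrite ler_pdivlMr//.
have : (v - u) * (2 * (1 - b ^+ 2) * rho) <= 2 + 2 * (16 / 9 * b ^+ 2).
  apply: (@le_trans _ _ ((v - u) * (B + C))); first by rewrite ler_wpM2l//; lra.
  rewrite key; nra.
set x := b ^+ 2 in x0 x1 *.
move=> h5.
have : (v - u) * rho * (1 - x) <= 1 + 16 / 9 * x by lra.
move=> h6; rewrite -(@ler_pM2r _ (1 - x)); last by lra.
apply: (le_trans h6); nra.
Qed.

(** A sum of [h] second differences. It supplies the hypothesis of [shift_sum] with [D = h / rho]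
    and [g = 4 * b ^+ 2]. *)
Lemma arc_diff_step rho b (y h : nat) : 0 < rho -> 0 < b -> b <= 2^-1 ->
  (y + h).+1%:R <= b * rho ->
  h%:R / rho <= (arc_height rho y.+1 - arc_height rho (y.+1 + h)) - (arc_height rho y - arc_height rho (y + h))
    <= (1 + 4 * b ^+ 2) * (h%:R / rho).
Proof.
move=> r0 b0 b1; elim: h => [|h IH] H.
  by rewrite !addn0 !subrr !mul0r mulr0 lexx.
have : (y + h).+1%:R <= b * rho by apply: le_trans H; rewrite ler_nat; lia.
move=> /IH /andP[h1 h2].
rewrite !addnS !addSn in H h1 h2 *.
have /andP[h3 h4] := arc_second_diff r0 b0 b1 H.
rewrite -natr1 mulrDl mulrDr mul1r.
by apply/andP; split; lra.
Qed.

Lemma arc_sub_le rho b (y w : nat) : 0 < rho -> 0 < b -> b <= 2^-1 ->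
  (y + w)%:R <= b * rho -> arc_height rho y - arc_height rho (y + w) <= w%:R.
Proof.
move=> r0 b0 b1 h.
have br : b * rho <= rho by rewrite ler_piMl//; lra.
have h' : y%:R <= b * rho by apply: le_trans h; rewrite ler_nat; lia.
have b1' : b <= 1 by lra.
have Ag := arc_ge r0 b0 b1' h'; have Bg := arc_ge r0 b0 b1' h.
have A2 := sqr_arc (le_trans h' br); have B2 := sqr_arc (le_trans h br).
have x1 : b ^+ 2 <= 4^-1 by nra.
move: h B2; rewrite natrD.
have : 0 <= y%:R :> R by rewrite ler0n.
have : 0 <= w%:R :> R by rewrite ler0n.
move: (arc_height rho y) (arc_height rho (y + w)) Ag Bg A2 => A B Ag Bg A2.
move: (y%:R : R) (w%:R : R) h' A2 => p q h' A2 q0 p0 h B2.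
have Ar : 3 / 4 * rho <= A by nra.
have Br : 3 / 4 * rho <= B by nra.
have e : (A - B) * (A + B) = q * (2 * p + q) by nra.
have : q * (2 * p + q) <= q * (A + B) by rewrite ler_wpM2l//; nra.
rewrite -e ler_pM2r//; lra.
Qed.

End Riemann.

(** * Averages over an arc *)

Section Circle.
Context {R : realType} {G : finZmodType}.
Implicit Types (F : G -> R) (e : G).

Lemma sum_sym_pairs (a : nat -> nat -> R) K :
  (forall y y', a y y' = a y' y) ->
  \sum_(y < K) \sum_(y' < K) a y y' =
  2 * \sum_(h < K) \sum_(y < K - h) a y (y + h)%N - \sum_(y < K) a y y.
Proof.
move=> sym; elim: K => [|K IH]; first by rewrite !big_ord0; lra.
have -> : \sum_(h < K.+1) \sum_(y < K.+1 - h) a y (y + h)%N =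
   \sum_(h < K) \sum_(y < K - h) a y (y + h)%N + \sum_(h < K.+1) a (K - h)%N K.
  rewrite (eq_bigr (fun h : 'I_K.+1 => \sum_(y < K - h) a y (y + h)%N + a (K - h)%N K)).
    rewrite big_split/= [X in X + _ = _]big_ord_recr/= subnn [X in _ + X + _ = _]big_ord0.
    by rewrite addr0.
  move=> [h hK] _ /=; have hK' : (h <= K)%N by [].
  by rewrite subSn// big_ord_recr/= subnK.
have -> : \sum_(y < K.+1) \sum_(y' < K.+1) a y y' =
    \sum_(y < K) \sum_(y' < K) a y y' + \sum_(y < K) a y K +
    (\sum_(y < K) a y K + a K K).
  rewrite big_ord_recr/= big_ord_recr/= -big_split/=; congr (_ + (_ + _)).
    by apply: eq_bigr => y _; rewrite big_ord_recr.
  by apply: eq_bigr => y _; rewrite sym.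
rewrite IH.
have -> : \sum_(h < K.+1) a (K - h)%N K = \sum_(y < K) a y K + a K K.
  rewrite -(big_mkord xpredT (fun h => a (K - h)%N K)) big_nat_rev/=.
  rewrite big_mkord big_ord_recr/= add0n subSS subnn subn0; congr (_ + _).
  by apply: eq_bigr => i _; rewrite subSS subKn// ltnW.
rewrite [\sum_(y < K.+1) a y y]big_ord_recr/=; lra.
Qed.

Definition smooth e k F : G -> R := fun x => (\sum_(u < k) F (x + e *+ u)) / k%:R.

Lemma unitval_smooth e k F : (0 < k)%N -> unitval F -> unitval (smooth e k F).
Proof.
move=> k0 h x; rewrite /smooth divr_ge0 ?ler0n ?sumr_ge0//=; last first.
  by move=> i _; case/andP: (h (x + e *+ i)).
rewrite ler_pdivrMr ?ltr0n// mul1r (le_trans (ler_sum _ (G := fun=> 1) _))//.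
  by move=> i _; case/andP: (h (x + e *+ i)).
by rewrite sumr_const card_ord.
Qed.

Lemma smooth_lip e k F x : (0 < k)%N -> unitval F ->
  `|smooth e k F (x + e) - smooth e k F x| <= k%:R^-1.
Proof.
move=> k0 h; rewrite /smooth -mulrBl normrM normfV normr_nat.
rewrite ler_piMl ?invr_ge0 ?ler0n// -sumrB.
rewrite (eq_bigr (fun u : 'I_k => F (x + e *+ u.+1) - F (x + e *+ u))); last first.
  by move=> u _; rewrite mulrS addrA.
rewrite -(big_mkord xpredT (fun u => F (x + e *+ u.+1) - F (x + e *+ u))).
rewrite telescope_sumr//.
have /andP[? ?] := h (x + e *+ k); have /andP[? ?] := h (x + e *+ 0).
by rewrite ler_norml; apply/andP; split; lra.
Qed.

Lemma corr_smooth_lip e k F s : (0 < k)%N -> unitval F ->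
  `|corr (smooth e k F) (s + e) - corr (smooth e k F) s| <= k%:R^-1.
Proof.
move=> k0 h; rewrite /corr -meanB (le_trans (normr_mean _))//.
rewrite -(@mean_cst R G k%:R^-1); apply: le_mean => x.
rewrite -mulrBr normrM addrA.
have /andP[a b] := unitval_smooth e k0 h x.
by rewrite ger0_norm// (le_trans (ler_piMl _ b))//; exact: smooth_lip.
Qed.

(** The arc rounded to the grid and thickened by [k] steps along [e1]. The thickening makes the
    averaged functions vary by at most [1 / k] per step along [e1], so that equidistribution at unit
    scale is enough. *)
Definition circle e1 e2 (rho : R) (K k : nat) : G -> R :=
  unif (fun yu : 'I_K * 'I_k =>
    e1 *+ (Num.trunc (arc_height rho yu.1) + yu.2) + e2 *+ yu.1).

Lemma prob_circle e1 e2 rho K k : (0 < K)%N -> (0 < k)%N ->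
  prob (circle e1 e2 rho K k).
Proof. by move=> K0 k0; apply: prob_unif; rewrite card_prod !card_ord muln_gt0 K0. Qed.

Definition arc_pt e1 e2 (rho : R) (y : nat) : G :=
  e1 *+ Num.trunc (arc_height rho y) + e2 *+ y.

Lemma expect_circle e1 e2 rho K k F :
  expect (circle e1 e2 rho K k) F =
  (\sum_(y < K) smooth e1 k F (arc_pt e1 e2 rho y)) / K%:R.
Proof.
rewrite expect_unif card_prod !card_ord /smooth -mulr_suml -mulrA -invfM -natrM.
rewrite [(k * K)%N]mulnC pair_big/=; congr (_ / _).
apply: eq_bigr => -[y u] _ /=; congr F.
by rewrite /arc_pt mulrnDr addrAC.
Qed.

(** At [z = 0] this is the form of the arc. Near invariance in [z] means that a further smoothing of
    the arc hardly changes the form. *)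
Definition circle_corr e1 e2 rho K k F (z : G) : R :=
  expect (circle e1 e2 rho K k) (fun v => corr F (v + z)).

Lemma circle_corrE e1 e2 rho K k F z :
  circle_corr e1 e2 rho K k F z =
  mean (fun x => F x *
    ((\sum_(y < K) smooth e1 k F (x + arc_pt e1 e2 rho y + z)) / K%:R)).
Proof.
rewrite /circle_corr expect_mean; apply: eq_mean => x; rewrite expectZ.
rewrite expect_circle; congr (_ * (_ / _)); apply: eq_bigr => y _.
rewrite /smooth; congr (_ / _); apply: eq_bigr => u _; congr F.
by rewrite -!addrA (addrC z).
Qed.

(** Cauchy-Schwarz removes the outer factor [F], which is bounded by 1. The remaining square expands
    over pairs of arc points, and translation invariance removes [z]. *)
Lemma circle_shift_sqr e1 e2 rho K k F z s : unitval F ->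
  (circle_corr e1 e2 rho K k F z - circle_corr e1 e2 rho K k F (z + s)) ^+ 2 <=
  (\sum_(y < K) \sum_(y' < K)
    corr (fun x => smooth e1 k F x - smooth e1 k F (x + s))
      (arc_pt e1 e2 rho y' - arc_pt e1 e2 rho y)) / K%:R ^+ 2.
Proof.
move=> h; set d := fun x => smooth e1 k F x - _; pose p := arc_pt e1 e2 rho.
rewrite !circle_corrE -meanB.
pose D x := (\sum_(y < K) d (x + p y + z)) / K%:R.
have -> : mean (fun x => F x * ((\sum_(y < K) smooth e1 k F (x + p y + z)) / K%:R) -
   F x * ((\sum_(y < K) smooth e1 k F (x + p y + (z + s))) / K%:R)) =
   mean (fun x => F x * D x).
  apply: eq_mean => x; rewrite -mulrBr -mulrBl -sumrB; congr (_ * (_ / _)).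
  by apply: eq_bigr => y _; rewrite /d -(addrA _ z s).
apply: (le_trans (cauchy_mean _ _)).
have D0 : 0 <= mean (fun x => D x ^+ 2) by apply: mean_ge0 => x; exact: sqr_ge0.
apply: (le_trans (ler_piMl D0 _)).
  rewrite -(@mean_cst R G 1); apply: le_mean => x; have /andP[? ?] := h x.
  by rewrite expr_le1.
rewrite le_eqVlt; apply/orP; left; apply/eqP.
rewrite (@eq_mean _ _ _ (fun x => K%:R ^- 2 * \sum_(y < K) \sum_(y' < K)
    d (x + p y + z) * d (x + p y' + z))); last first.
  move=> x; rewrite /D exprMn exprVn mulrC; congr (_ * _).
  by rewrite expr2 big_distrlr.
rewrite meanZ mulrC; congr (_ / _).
rewrite mean_sum; apply: eq_bigr => y _; rewrite mean_sum; apply: eq_bigr => y' _.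
rewrite /corr -(mean_shift (fun x => d x * d (x + (p y' - p y))) (p y + z)).
apply: eq_mean => x; congr (d _ * d _); first by rewrite -addrA.
move: (p y) (p y') => s1 s2; rewrite -!addrA; congr (x + _).
by rewrite [RHS]addrCA [s1 + _]addrC subrK addrC.
Qed.

(* The averages of F along the arc are nearly invariant under small shifts in
   the first direction: after Cauchy-Schwarz the pair correlations at vertical
   distance h run through the horizontal displacements arc_height y - arc_height (y + h),
   whose steps are nearly constant in y. *)
Lemma circle_shift_dir1 e1 e2 (rho b : R) K k h0 w F z : unitval F ->
  0 < rho -> 0 < b -> b <= 2^-1 -> (0 < K)%N -> (0 < k)%N -> (0 < h0)%N ->
  K%:R <= b * rho ->
  (circle_corr e1 e2 rho K k F z - circle_corr e1 e2 rho K k F (z + e1 *+ w)) ^+ 2 <=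
  2 * h0%:R / K%:R + K%:R^-1 + 32 * b ^+ 2 + 8 * w%:R * rho / (h0%:R * K%:R)
    + 32 / k%:R.
Proof.
move=> hF r0 b0 b1 K0 k0 h00 Kb.
apply: (le_trans (circle_shift_sqr _ _ _ _ _ _ _ hF)).
set H := smooth e1 k F; pose p := arc_pt e1 e2 rho.
have hH : unitval H by exact: unitval_smooth.
set d := fun x => H x - _.
have dcorr s : corr d s = 2 * corr H s - corr H (s + e1 *+ w) - corr H (s - e1 *+ w).
  exact: corr_diff.
have d1 s : `|corr d s| <= 1.
  rewrite (le_trans (normr_mean _))// -(@mean_cst R G 1); apply: le_mean => x.
  have dd y : `|d y| <= 1.
    rewrite /d; have /andP[? ?] := hH y; have /andP[? ?] := hH (y + e1 *+ w).
    by rewrite ler_norml; apply/andP; split; lra.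
  by rewrite normrM mulr_ile1.
have K0' : 0 < K%:R :> R by rewrite ltr0n.
have k0' : 0 < k%:R :> R by rewrite ltr0n.
have h00' : 0 < h0%:R :> R by rewrite ltr0n.
have g1 : 4 * b ^+ 2 <= 1 by nra.
have g0 : 0 <= 4 * b ^+ 2 by nra.
(* The bound of [shift_sum] for [g = 4 * b ^+ 2 <= 1], Lipschitz constant [1 / k], steps at least
   [h0 / rho] and at most [K] terms. *)
pose E := 2 * (4 * b ^+ 2) * K%:R + 2 * w%:R * rho / h0%:R + 8 * K%:R / k%:R.
have E0 : 0 <= E.
  have w0 : 0 <= w%:R :> R by rewrite ler0n.
  have K1 := ltW K0'; have k1 := ltW k0'; have r1 := ltW r0; have h1 := ltW h00'.
  have E1 : 0 <= 2 * w%:R * rho / h0%:R by rewrite !mulr_ge0 ?invr_ge0.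
  have E2 : 0 <= 8 * K%:R / k%:R :> R by rewrite !mulr_ge0 ?invr_ge0.
  have E3 : 0 <= 2 * (4 * b ^+ 2) * K%:R by rewrite !mulr_ge0// ltW.
  by rewrite /E !addr_ge0.
have inner h : (h0 <= h)%N -> (h < K)%N ->
    `|\sum_(y < K - h) corr d (p (y + h)%N - p y)| <= 2 * E.
  move=> h0h hK.
  pose n y := (Num.trunc (arc_height rho y) - Num.trunc (arc_height rho (y + h)))%N.
  pose v y := arc_height rho y - arc_height rho (y + h).
  have h_gt0 : 0 < h%:R :> R by rewrite ltr0n (leq_trans h00).
  have one (c : nat -> R) : (forall i, `|c i| <= 1) -> (forall i, `|c i.+1 - c i| <= k%:R^-1) ->
      `|\sum_(y < K - h) (c (n y + w)%N - c (n y))| <= E.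
    move=> c1 cl.
    have hs := @shift_sum R c (k%:R^-1) (h%:R / rho) (4 * b ^+ 2) v n (K - h) w c1 cl.
    apply: (le_trans (hs _ g0 _ _ _ _)).
    - by rewrite divr_gt0.
    - have : h%:R / rho <= b.
        rewrite ler_pdivrMr// (le_trans _ Kb)// ler_nat ltnW//.
      have : 0 < h%:R / rho by rewrite divr_gt0.
      by nra.
    - by rewrite /v subr_ge0 le_arc// leq_addr.
    - move=> y yK; apply: arc_diff_step => //; apply: le_trans Kb.
      by rewrite ler_nat addnC -ltn_subRL.
    - move=> y yK; rewrite /n /v.
      have a0 := arc_ge0 rho y; have a1 := arc_ge0 rho (y + h).
      have le : arc_height rho (y + h) <= arc_height rho y by rewrite le_arc// leq_addr.
      rewrite natrB ?le_truncn//.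
      move: (truncn_itv a0) (truncn_itv a1).
      rewrite -!natr1 ler_norml => /andP[? ?] /andP[? ?].
      by apply/andP; split; lra.
    rewrite /E; have m1 : (K - h)%:R <= K%:R :> R by rewrite ler_nat leq_subr.
    have m0 : 0 <= (K - h)%:R :> R by rewrite ler0n.
    rewrite lerD//; first rewrite lerD//.
    - by rewrite ler_wpM2l// mulr_ge0.
    - rewrite invf_div mulrA ler_wpM2l// ?mulr_ge0 ?ler0n// ?(ltW r0)//.
      by rewrite lef_pV2 ?posrE// ler_nat.
    have h2 : (1 + 4 * b ^+ 2) * (K - h)%:R <= 2 * K%:R.
      rewrite ler_pM// ?addr_ge0//; lra.
    have -> : 8 * K%:R / k%:R = 4 * k%:R^-1 * (2 * K%:R) :> R by ring.
    by rewrite -[leLHS]mulrA ler_wpM2l// mulr_ge0 ?invr_ge0.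
  pose z' : G := - (e2 *+ h).
  (* The symmetric second difference in [dcorr] is the difference of two first differences along the
     same sequence [n], based at [z' - e1 *+ w] and at [z']; [one] bounds each. *)
  have -> : \sum_(y < K - h) corr d (p (y + h)%N - p y) =
     \sum_(y < K - h) (corr H (e1 *+ (n y + w) + (z' - e1 *+ w))
                      - corr H (e1 *+ n y + (z' - e1 *+ w))) -
     \sum_(y < K - h) (corr H (e1 *+ (n y + w) + z') - corr H (e1 *+ n y + z')).
    rewrite -sumrB; apply: eq_bigr => y _; rewrite -corrN.
    have -> : - (p (y + h)%N - p y) = e1 *+ n y + z'.
      rewrite opprB /p /arc_pt /n /z' mulrnBr ?le_truncn ?le_arc ?leq_addr//.
      by rewrite mulrnDr opprD addrACA; congr (_ + _); rewrite opprD addrA subrr sub0r.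
    rewrite dcorr mulrnDr.
    have -> : e1 *+ n y + e1 *+ w + (z' - e1 *+ w) = e1 *+ n y + z'.
      by rewrite addrACA subrr addr0.
    rewrite [e1 *+ n y + e1 *+ w + z']addrAC [e1 *+ n y + (z' - _)]addrA; lra.
  have bnd (z1 : G) : forall i, `|corr H (e1 *+ i + z1)| <= 1.
    move=> i; have /andP[? ?] := unitval_corr hH (e1 *+ i + z1).
    by rewrite ger0_norm.
  have lip (z1 : G) : forall i, `|corr H (e1 *+ i.+1 + z1) - corr H (e1 *+ i + z1)| <= k%:R^-1.
    move=> i; rewrite mulrSr [e1 *+ i + e1 + z1]addrAC.
    exact: corr_smooth_lip.
  have := one _ (bnd (z' - e1 *+ w)) (lip _).
  have := one _ (bnd z') (lip _).
  rewrite !ler_norml => /andP[? ?] /andP[? ?]; apply/andP; split; lra.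
rewrite (@sum_sym_pairs (fun y y' => corr d (p y' - p y))); last first.
  by move=> y y'; rewrite -corrN opprB.
set U := \sum_(h < K) _; set V := \sum_(y < K) _.
have hV : `|V| <= K%:R.
  rewrite (le_trans (ler_norm_sum _ _ _))// (le_trans (ler_sum _ (G := fun=> 1) _))//.
  by rewrite sumr_const card_ord.
have hU : `|U| <= h0%:R * K%:R + K%:R * (2 * E).
  rewrite (le_trans (ler_norm_sum _ _ _))//.
  (* At vertical distance below [h0] the steps [h / rho] are too small to be useful; these pairs, at
     most [h0 * K] of them, are bounded trivially. *)
  apply: (@le_trans _ _ (\sum_(h < K) ((h < h0)%N%:R * K%:R + 2 * E))).
    apply: ler_sum => h _; have [hh|hh] := ltnP h h0; last first.
      by rewrite mul0r add0r inner.
    rewrite mul1r (le_trans (ler_norm_sum _ _ _))// (le_trans (ler_sum _ (G := fun=> 1) _))//.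
    rewrite sumr_const card_ord -[leLHS]addr0 lerD ?mulr_ge0//.
    by rewrite ler_nat leq_subr.
  rewrite big_split/= sumr_const card_ord -[2 * E *+ K]mulr_natl lerD2r -mulr_suml.
  rewrite ler_wpM2r ?ler0n// -natr_sum ler_nat.
  suff -> : (\sum_(i < K) (i < h0) = minn K h0)%N by exact: geq_minr.
  elim: K {K0 Kb K0' E E0 inner U V hV} => [|K IH]; first by rewrite big_ord0 min0n.
  by rewrite big_ord_recr/= IH; lia.
have e : 2 * h0%:R / K%:R + K%:R^-1 + 32 * b ^+ 2 + 8 * w%:R * rho / (h0%:R * K%:R)
    + 32 / k%:R = (2 * (h0%:R * K%:R + K%:R * (2 * E)) + K%:R) / K%:R ^+ 2.
  rewrite /E; field.
  by rewrite !gt_eqF.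
rewrite e ler_pM2r ?invr_gt0 ?exprn_gt0//.
move: hU hV; rewrite !ler_norml => /andP[? ?] /andP[? ?]; lra.
Qed.

End Circle.

Section Smoothing.
Context {R : realType} {G : finZmodType}.
Implicit Types (F q : G -> R) (e z : G).

Lemma smooth_lipn e k F x (d : nat) : (0 < k)%N -> unitval F ->
  `|smooth e k F (x + e *+ d) - smooth e k F x| <= d%:R / k%:R.
Proof.
move=> k0 h; elim: d => [|d IH]; first by rewrite addr0 subrr normr0 mul0r.
rewrite [e *+ d.+1]mulrSr addrA -(subrKA (smooth e k F (x + e *+ d))).
apply: (le_trans (ler_normD _ _)).
have -> : d.+1%:R / k%:R = k%:R^-1 + d%:R / k%:R :> R by rewrite -natr1; ring.
by rewrite lerD// smooth_lip.
Qed.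

Lemma sum_ord_split (f : nat -> R) (m n : nat) : (m <= n)%N ->
  \sum_(i < n) f i = \sum_(i < m) f i + \sum_(i < n - m) f (m + i)%N.
Proof.
move=> mn; suff H k : \sum_(i < m + k) f i =
    \sum_(i < m) f i + \sum_(i < k) f (m + i)%N by rewrite -H subnKC.
by rewrite big_split_ord.
Qed.

Lemma circle_corr_smooth e1 e2 (rho : R) K k F z :
  circle_corr e1 e2 rho K k F z =
  (\sum_(y < K) smooth e1 k (corr F) (arc_pt e1 e2 rho y + z)) / K%:R.
Proof.
rewrite /circle_corr expect_circle; congr (_ / _); apply: eq_bigr => y _.
by rewrite /smooth; congr (_ / _); apply: eq_bigr => u _; rewrite addrAC.
Qed.

Lemma arc_trunc_sub (rho b : R) (y w : nat) : 0 < rho -> 0 < b -> b <= 2^-1 ->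
  (y + w)%:R <= b * rho ->
  (Num.trunc (arc_height rho (y + w)) <= Num.trunc (arc_height rho y) <=
     Num.trunc (arc_height rho (y + w)) + w)%N.
Proof.
move=> r0 b0 b1 h; apply/andP; split; first by rewrite le_truncn// le_arc// leq_addr.
have := arc_sub_le r0 b0 b1 h.
move: (truncn_itv (arc_ge0 rho (y + w))) (truncn_itv (arc_ge0 rho y)).
move=> /andP[_ h1] /andP[h2 _] h3.
rewrite -ltnS -(ltr_nat R) -addSn natrD; lra.
Qed.

(* Shifts in the second direction are absorbed by the smoothing available in
   the first one: reindexing y turns them into small horizontal ones. *)
Lemma circle_shift_dir2 e1 e2 (rho b d : R) K k l w F z : unitval F ->
  0 < rho -> 0 < b -> b <= 2^-1 -> (0 < K)%N -> (0 < k)%N -> (0 < l)%N ->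
  K%:R <= b * rho ->
  (forall u z', (u < l)%N -> `|circle_corr e1 e2 rho K k F z'
     - circle_corr e1 e2 rho K k F (z' + e1 *+ u)| <= d) ->
  `|circle_corr e1 e2 rho K k F z - circle_corr e1 e2 rho K k F (z + e2 *+ w)|
    <= 2 * d + 2 * w%:R / K%:R + w%:R / l%:R.
Proof.
move=> hF r0 b0 b1 K0 k0 l0 Kb hd.
pose B := circle_corr e1 e2 rho K k F.
(* By hypothesis this average is within [d] of [B]. It is also an average over the arc of [Q], which
   changes by at most [w / l] under [w] steps along [e1]. *)
pose Bs z' := (\sum_(u < l) B (z' + e1 *+ u)) / l%:R.
have l0' : 0 < l%:R :> R by rewrite ltr0n.
have K0' : 0 < K%:R :> R by rewrite ltr0n.
have BsB z' : `|Bs z' - B z'| <= d.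
  have -> : Bs z' - B z' = (\sum_(u < l) (B (z' + e1 *+ u) - B z')) / l%:R.
    rewrite sumrB mulrBl; congr (_ - _).
    by rewrite sumr_const card_ord -[B z' *+ l]mulr_natr mulfK// gt_eqF.
  rewrite normrM normfV normr_nat ler_pdivrMr// (le_trans (ler_norm_sum _ _ _))//.
  rewrite (le_trans (ler_sum _ (G := fun=> d) _))//.
    by move=> u _; rewrite distrC hd.
  by rewrite sumr_const card_ord -[d *+ l]mulr_natr.
pose g := smooth e1 k (corr F); pose Q := smooth e1 l g.
have hg : unitval g by apply: unitval_smooth => //; exact: unitval_corr.
have hQ : unitval Q by exact: unitval_smooth.
have BsE z' : Bs z' = (\sum_(y < K) Q (arc_pt e1 e2 rho y + z')) / K%:R.
  rewrite /Bs (eq_bigr (fun u : 'I_l =>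
    (\sum_(y < K) g (arc_pt e1 e2 rho y + (z' + e1 *+ u))) / K%:R)); last first.
    by move=> u _; rewrite /B circle_corr_smooth.
  rewrite -mulr_suml exchange_big/= mulrAC mulr_suml; congr (_ / _).
  apply: eq_bigr => y _; rewrite /Q /smooth; congr (_ / _).
  by apply: eq_bigr => u _; rewrite addrA.
pose t y := Num.trunc (arc_height rho y).
pose a i y := Q (e1 *+ i + e2 *+ y + z).
have a1 i y : 0 <= a i y <= 1 by exact: hQ.
have alip i i' y : (i <= i' <= i + w)%N -> `|a i' y - a i y| <= w%:R / l%:R.
  move=> /andP[ii' i'w]; rewrite /a.
  have -> : e1 *+ i' + e2 *+ y + z = e1 *+ i + e2 *+ y + z + e1 *+ (i' - i).
    by rewrite -{1}(subnKC ii') mulrnDr -!addrA; congr (_ + _); rewrite addrC -addrA.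
  apply: (le_trans (smooth_lipn _ _ _ _ _)) => //.
  rewrite ler_pM2r ?invr_gt0// ler_nat.
  by rewrite leq_subLR.
have main : `|Bs z - Bs (z + e2 *+ w)| <= 2 * w%:R / K%:R + w%:R / l%:R.
  have -> : Bs z - Bs (z + e2 *+ w) =
      (\sum_(y < K) a (t y) y - \sum_(y < K) a (t y) (y + w)%N) / K%:R.
    rewrite !BsE -mulrBl; congr ((_ - _) / _).
    apply: eq_bigr => y _; rewrite /a /arc_pt; congr Q.
    by rewrite mulrnDr -!addrA; congr (_ + (_ + _)); rewrite addrC.
  rewrite normrM normfV normr_nat ler_pdivrMr// mulrDl mulfVK ?gt_eqF//.
  have [Kw|wK] := leqP K w.
    rewrite -sumrB (le_trans (ler_norm_sum _ _ _))//.
    rewrite (le_trans (ler_sum _ (G := fun=> 1) _))//.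
      move=> y _; have /andP[? ?] := a1 (t y) y; have /andP[? ?] := a1 (t y) (y + w)%N.
      by rewrite ler_norml; apply/andP; split; lra.
    rewrite sumr_const card_ord.
    have w0 : 0 <= w%:R :> R by rewrite ler0n.
    have : K%:R <= w%:R :> R by rewrite ler_nat.
    have : 0 <= w%:R / l%:R * K%:R :> R by rewrite !mulr_ge0 ?invr_ge0 ?ler0n.
    lra.
  (* The term [w + y] of the first sum is paired with the term [y] of the second: the [e2]
     coordinates agree, and the [e1] coordinates differ by at most [w] since the arc has slope at
     most 1. On either side [w] terms stay unpaired. *)
  have e1' : \sum_(y < K) a (t y) y =
     \sum_(y < w) a (t y) y + \sum_(y < K - w) a (t (w + y)%N) (w + y)%N.
    exact: (sum_ord_split (fun y => a (t y) y) (ltnW wK)).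
  have e2' : \sum_(y < K) a (t y) (y + w)%N =
     \sum_(y < K - w) a (t y) (w + y)%N + \sum_(y < w) a (t (K - w + y)%N) (K - w + y + w)%N.
    rewrite (sum_ord_split (fun y => a (t y) (y + w)%N) (leq_subr w K)).
    rewrite subKn ?(ltnW wK)//; congr (_ + _).
    by apply: eq_bigr => y _; rewrite addnC.
  rewrite e1' e2'.
  set X := \sum_(y < w) _; set Y := \sum_(y < K - w) _.
  set Z := \sum_(y < K - w) _; set W := \sum_(y < w) _.
  have hX : 0 <= X <= w%:R.
    apply/andP; split; first by apply: sumr_ge0 => y _; case/andP: (a1 (t y) y).
    rewrite (le_trans (ler_sum _ (G := fun=> 1) _)) ?sumr_const ?card_ord//.
    by move=> y _; case/andP: (a1 (t y) y).
  have hW : 0 <= W <= w%:R.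
    apply/andP; split.
      by apply: sumr_ge0 => y _; case/andP: (a1 (t (K - w + y)%N) (K - w + y + w)%N).
    rewrite (le_trans (ler_sum _ (G := fun=> 1) _)) ?sumr_const ?card_ord//.
    by move=> y _; case/andP: (a1 (t (K - w + y)%N) (K - w + y + w)%N).
  have hYZ : `|Y - Z| <= w%:R / l%:R * K%:R.
    rewrite -sumrB (le_trans (ler_norm_sum _ _ _))//.
    rewrite (le_trans (ler_sum _ (G := fun=> w%:R / l%:R) _))//.
      move=> y _; rewrite distrC alip//.
      rewrite [(w + y)%N]addnC; apply: (arc_trunc_sub r0 b0 b1).
      rewrite (le_trans _ Kb)// ler_nat addnC -leq_subRL ?(ltnW wK)//.
      by rewrite ltnW.
    rewrite sumr_const card_ord -[_ *+ (K - w)]mulr_natr.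
    by apply: ler_wpM2l; [rewrite divr_ge0 ?ler0n|rewrite ler_nat leq_subr].
  move: hX hW hYZ; rewrite !ler_norml => /andP[? ?] /andP[? ?] /andP[? ?].
  by apply/andP; split; lra.
have := BsB z; have := BsB (z + e2 *+ w).
move: main; rewrite -/B !ler_norml => /andP[? ?] /andP[? ?] /andP[? ?].
by apply/andP; split; lra.
Qed.

End Smoothing.

Lemma circle_smoothing {R : realType} (eta : R) : 0 < eta ->
  exists b : R, exists k : nat, exists eps : R, exists rho1 : R,
  [/\ 0 < b <= 2^-1, (0 < k)%N, 0 < eps, 1 <= rho1 &
   forall (G : finZmodType) (e1 e2 : G) (F : G -> R) (rho : R) (z : G) (w : nat),
   unitval F -> rho1 <= rho -> w%:R <= eps * rho ->
   [/\ (0 < Num.trunc (b * rho))%N,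
    `|circle_corr e1 e2 rho (Num.trunc (b * rho)) k F z -
      circle_corr e1 e2 rho (Num.trunc (b * rho)) k F (z + e1 *+ w)| <= eta &
    `|circle_corr e1 e2 rho (Num.trunc (b * rho)) k F z -
      circle_corr e1 e2 rho (Num.trunc (b * rho)) k F (z + e2 *+ w)| <= eta]].
Proof.
move=> eta0; pose d := eta / 4.
have d0 : 0 < d by rewrite divr_gt0.
(* Each group of terms in [circle_shift_dir1] is to be at most [d ^+ 2 / 8]. The choice of [b] and
   [k] settles [32 * b ^+ 2] and [32 / k]; [ze] is the ratio of [h0] to [K], and [eps1] bounds the
   ratio of the shift to [rho]. *)
pose b := Num.min (2^-1) (d / 16); pose k := (Num.trunc (256 / d ^+ 2)).+1.
pose ze := d ^+ 2 / 16; pose eps1 := ze * b ^+ 2 * d ^+ 2 / 256.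
have b0 : 0 < b by rewrite lt_min invr_gt0 ltr0n/= divr_gt0.
have b12 : b <= 2^-1 by rewrite ge_min lexx.
have bd : b <= d / 16 by rewrite ge_min lexx orbT.
have d2 : 0 < d ^+ 2 by rewrite exprn_gt0.
have ze0 : 0 < ze by rewrite divr_gt0.
have b20 : 0 < b ^+ 2 by rewrite exprn_gt0.
have eps10 : 0 < eps1 by rewrite divr_gt0// mulr_gt0// mulr_gt0.
have k0' : 0 < k%:R :> R by rewrite ltr0n.
have kd : 32 / k%:R <= d ^+ 2 / 8.
  rewrite ler_pdivrMr//.
  have : 256 / d ^+ 2 < k%:R by exact: truncnS_gt.
  by rewrite ltr_pdivrMr//; lra.
(* The last two bounds make [2 * w / K] and [w / l] at most [eta / 8] in the second direction. *)
pose eps := Num.min eps1 (Num.min (b * eta / 32) (eps1 * eta / 32)).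
have eps0 : 0 < eps by rewrite !lt_min eps10 !divr_gt0// mulr_gt0.
(* The summands after 1 ensure in turn that [K >= b * rho / 2 >= 1], that [3 / K] is negligible, and
   that [l >= eps1 * rho / 2 >= 1]. *)
pose rho1 := 1 + 2 / b + 48 / (b * d ^+ 2) + 2 / eps1.
have [i1 i2 i3] : [/\ 0 <= 2 / b, 0 <= 48 / (b * d ^+ 2) & 0 <= 2 / eps1].
  by split; apply: divr_ge0 => //; rewrite ltW// mulr_gt0.
exists b, k, eps, rho1; split => //; first by rewrite b0.
  by rewrite /rho1; lra.
move=> G e1 e2 F rho z w hF hrho hw.
have r1 : 1 <= rho by apply: le_trans hrho; rewrite /rho1; lra.
have r0 : 0 < rho by lra.
pose K := Num.trunc (b * rho).
have br2 : 2 <= b * rho.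
  have : 2 / b <= rho by apply: le_trans hrho; rewrite /rho1; lra.
  by rewrite ler_pdivrMr// mulrC.
have Kb : K%:R <= b * rho by rewrite truncn_le mulr_ge0// ltW.
have Kb2 : b * rho / 2 <= K%:R.
  have := truncnS_gt (b * rho); rewrite -natr1 -/K; lra.
have K0 : (0 < K)%N by rewrite -(ltr_nat R); lra.
have K0' : 0 < K%:R :> R by rewrite ltr0n.
have dir1 z' (u : nat) : u%:R <= eps1 * rho ->
    `|circle_corr e1 e2 rho K k F z' - circle_corr e1 e2 rho K k F (z' + e1 *+ u)| <= d.
  move=> hu; pose h0 := (Num.trunc (ze * K%:R)).+1.
  have := circle_shift_dir1 e1 e2 u z' hF r0 b0 b12 K0 (ltn0Sn _ : (0 < k)%N) (ltn0Sn _ : (0 < h0)%N) Kb.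
  have h00 : 0 < h0%:R :> R by rewrite ltr0n.
  have zeK : ze * K%:R < h0%:R by exact: truncnS_gt.
  have zeK' : h0%:R <= ze * K%:R + 1.
    by rewrite -natr1 lerD2r truncn_le mulr_ge0 ?ler0n// ltW.
  have t1 : 2 * h0%:R / K%:R <= d ^+ 2 / 8 + 2 / K%:R.
    rewrite ler_pdivrMr// [(_ + _) * K%:R]mulrDl mulfVK ?gt_eqF//.
    have -> : d ^+ 2 / 8 = 2 * ze by rewrite /ze; field.
    lra.
  have t2 : 3 / K%:R <= d ^+ 2 / 8.
    rewrite ler_pdivrMr//.
    have : 48 / (b * d ^+ 2) <= rho by apply: le_trans hrho; rewrite /rho1; lra.
    have bd0 : 0 < b * d ^+ 2 := mulr_gt0 b0 d2.
    rewrite ler_pdivrMr// => h48.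
    have : d ^+ 2 / 8 * (b * rho / 2) <= d ^+ 2 / 8 * K%:R by rewrite ler_wpM2l// divr_ge0// ltW.
    lra.
  have t3 : 32 * b ^+ 2 <= d ^+ 2 / 8.
    have : b ^+ 2 <= (d / 16) ^+ 2 by rewrite lerXn2r// nnegrE ltW// divr_gt0.
    by rewrite expr_div_n; lra.
  have t4 : 8 * u%:R * rho / (h0%:R * K%:R) <= d ^+ 2 / 8.
    rewrite ler_pdivrMr ?mulr_gt0//.
    have : ze * K%:R * K%:R <= h0%:R * K%:R by rewrite ler_wpM2r// ltW.
    have : (b * rho / 2) * (b * rho / 2) <= K%:R * K%:R by rewrite ler_pM// ltW// divr_gt0// mulr_gt0.
    move=> e1' e2'.
    have : ze * ((b * rho / 2) * (b * rho / 2)) <= h0%:R * K%:R.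
      by apply: le_trans e2'; rewrite -[leRHS]mulrA ler_wpM2l// ltW.
    move=> e3; have : d ^+ 2 / 8 * (ze * ((b * rho / 2) * (b * rho / 2))) <= d ^+ 2 / 8 * (h0%:R * K%:R).
      by rewrite ler_wpM2l// divr_ge0// ltW.
    apply: le_trans.
    have : u%:R * rho <= eps1 * rho * rho by rewrite ler_wpM2r// ltW.
    rewrite /eps1; lra.
  have e0 : 3 / K%:R = 2 / K%:R + K%:R^-1 :> R by field; rewrite gt_eqF.
  move=> hh; rewrite -(@ler_pXn2r _ 2) ?nnegrE ?normr_ge0 ?(ltW d0)//.
  rewrite real_normK ?num_real// (le_trans hh)//; lra.
have [w1 w2 w3] : [/\ w%:R <= eps1 * rho, w%:R <= b * eta / 32 * rho & w%:R <= eps1 * eta / 32 * rho].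
  by split; apply: (le_trans hw); rewrite ler_wpM2r ?(ltW r0)// /eps !ge_min lexx ?orbT.
split => //.
  by rewrite (le_trans (dir1 _ _ w1))// /d; lra.
pose l := Num.trunc (eps1 * rho).
have er2 : 2 <= eps1 * rho.
  have : 2 / eps1 <= rho by apply: le_trans hrho; rewrite /rho1; lra.
  by rewrite ler_pdivrMr// mulrC.
have lb : l%:R <= eps1 * rho by rewrite truncn_le; lra.
have lb2 : eps1 * rho / 2 <= l%:R.
  have := truncnS_gt (eps1 * rho); rewrite -natr1 -/l; lra.
have l0 : (0 < l)%N by rewrite -(ltr_nat R); lra.
have l0' : 0 < l%:R :> R by rewrite ltr0n.
have := @circle_shift_dir2 R G e1 e2 rho b d K k l w F z hF r0 b0 b12 K0 (ltn0Sn _ : (0 < k)%N) l0 Kb.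
move=> hh; apply: (le_trans (hh _)).
  by move=> u z' ul; apply: dir1; apply: le_trans lb; rewrite ler_nat ltnW.
have s1 : 2 * w%:R / K%:R <= eta / 8.
  rewrite ler_pdivrMr//.
  apply: (@le_trans _ _ (eta / 8 * (b * rho / 2))).
    have -> : eta / 8 * (b * rho / 2) = 2 * (b * eta / 32 * rho) by field.
    by rewrite ler_wpM2l.
  by rewrite ler_wpM2l// divr_ge0// ltW.
have s2 : w%:R / l%:R <= eta / 8.
  rewrite ler_pdivrMr//.
  apply: (@le_trans _ _ (eta / 8 * (eps1 * rho / 2))).
    have -> : eta / 8 * (eps1 * rho / 2) = 2 * (eps1 * eta / 32 * rho) by field.
    apply: (le_trans w3); rewrite ler_peMl//; last by lra.
    by rewrite (le_trans _ w3).
  by rewrite ler_wpM2l// divr_ge0// ltW.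
rewrite /d; lra.
Qed.

(** * Smoothing at separated scales *)

Section Grid.
Context {R : realType} {G : finZmodType}.
Implicit Types (F q c p : G -> R) (e z v : G).

Definition grid e1 e2 N : G -> R :=
  unif (fun uv : 'I_N * 'I_N => e1 *+ uv.1 + e2 *+ uv.2).

Lemma prob_grid e1 e2 N : (0 < N)%N -> prob (grid e1 e2 N).
Proof. by move=> N0; apply: prob_unif; rewrite card_prod !card_ord muln_gt0 N0. Qed.

Lemma expect_grid e1 e2 N q :
  expect (grid e1 e2 N) q =
  (\sum_(u < N) \sum_(v < N) q (e1 *+ u + e2 *+ v)) / N%:R ^+ 2.
Proof. by rewrite expect_unif card_prod !card_ord natrM -expr2 pair_big. Qed.

Lemma expect_grid_smooth e1 e2 N q z :
  expect (grid e1 e2 N) (fun x => q (x + z)) = smooth e1 N (smooth e2 N q) z.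
Proof.
rewrite expect_grid /smooth -mulr_suml -mulrA -invfM -expr2; congr (_ / _).
apply: eq_bigr => u _; apply: eq_bigr => v _; congr q.
by rewrite -[RHS]addrA addrC.
Qed.

Lemma smoothC e1 e2 N q z :
  smooth e1 N (smooth e2 N q) z = smooth e2 N (smooth e1 N q) z.
Proof.
rewrite /smooth -!mulr_suml exchange_big; congr (_ / _ / _).
by apply: eq_bigr => u _; apply: eq_bigr => v _; rewrite addrAC.
Qed.

Lemma grid_shift e1 e2 N q (v1 v2 : nat) : (0 < N)%N -> unitval q ->
  `|expect (grid e1 e2 N) (fun x => q (x + (e1 *+ v1 + e2 *+ v2))) -
    expect (grid e1 e2 N) q| <= (v1 + v2)%:R / N%:R.
Proof.
move=> N0 hq.
have -> : expect (grid e1 e2 N) q = smooth e1 N (smooth e2 N q) 0.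
  by rewrite -expect_grid_smooth; apply: eq_expect => x; rewrite addr0.
rewrite expect_grid_smooth -(subrKA (smooth e1 N (smooth e2 N q) (e1 *+ v1))).
rewrite (le_trans (ler_normD _ _))// addnC natrD mulrDl lerD//.
  by rewrite !(smoothC e1); apply: smooth_lipn => //; exact: unitval_smooth.
by rewrite -[e1 *+ v1]add0r; apply: smooth_lipn => //; exact: unitval_smooth.
Qed.

Lemma expect_autoconvN c q :
  expect (conv c (refl c)) (fun x => q (- x)) = expect (conv c (refl c)) q.
Proof.
rewrite !expect_conv.
under eq_expect do rewrite expect_refl.
under [RHS]eq_expect do rewrite expect_refl.
rewrite expect_swap; apply: eq_expect => x; apply: eq_expect => y.
by rewrite opprB.
Qed.

(** Averaging [corr_second_diff] over [w] with the symmetric law [conv c (refl c)] bounds [corr F v]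
    from below by its smoothed value at [v], up to the loss in the form; the hypothesis replaces
    that value by the one at 0. *)
Lemma qform_autoconv_shift c F v d : prob c ->
  `|expect (conv c (refl c)) (fun w => corr F (v + w)) - qform (conv c (refl c)) F|
    <= d ->
  qform (conv c (refl c)) F <=
    corr F v + (corr F 0 - qform (conv c (refl c)) F) + d.
Proof.
move=> pc; set a := conv c (refl c).
have pa : prob a by apply: prob_conv => //; exact: prob_refl.
have h : expect a (fun w => - (2 * corr F 0 - 2 * corr F w)) <=
    expect a (fun w => 2 * corr F v - corr F (v + w) - corr F (v - w)).
  apply: le_expect pa.1 _ => w _.
  by have := corr_second_diff F v w; rewrite ler_norml => /andP[].
have e1 : expect a (fun w => - (2 * corr F 0 - 2 * corr F w)) =
   2 * qform a F - 2 * corr F 0.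
  rewrite (@eq_expect _ _ a _ (fun w => 2 * corr F w - 2 * corr F 0)).
    by rewrite expectB expectZ expect_cst.
  by move=> w; rewrite opprB.
have e2 : expect a (fun w => 2 * corr F v - corr F (v + w) - corr F (v - w)) =
   2 * corr F v - 2 * expect a (fun w => corr F (v + w)).
  rewrite expectB expectB expect_cst//.
  by rewrite -(expect_autoconvN c (fun w => corr F (v + w))) -/a; lra.
move: h; rewrite e1 e2 ler_norml => h /andP[? ?]; lra.
Qed.

Lemma sum_ord_ge (f : nat -> R) (m l N : nat) : (forall i, 0 <= f i) ->
  (m + l <= N)%N -> \sum_(i < l) f (m + i)%N <= \sum_(u < N) f u.
Proof.
move=> f0 h; rewrite (@sum_ord_split R f m N); last by lia.
rewrite (@sum_ord_split R (fun i => f (m + i)%N) l (N - m)); last by lia.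
by rewrite addrCA lerDl addr_ge0// sumr_ge0.
Qed.

(** The difference [v + i] arises from the [l] pairs [(v + i + u', u')] with [u' < l], all of whose
    entries stay below [N]. *)
Lemma difference_cover e N l (v : nat) q : (forall x, 0 <= q x) ->
  (v + 2 * l <= N)%N ->
  l%:R * \sum_(i < l) q (e *+ (v + i)) <=
  \sum_(u < N) \sum_(u' < N) q (e *+ u - e *+ u').
Proof.
move=> q0 h; rewrite exchange_big/=.
apply: (@le_trans _ _ (\sum_(u' < l) \sum_(u < N) q (e *+ u - e *+ u'))).
  have -> : l%:R * \sum_(i < l) q (e *+ (v + i)) =
      \sum_(u' < l) \sum_(i < l) q (e *+ (v + i)).
    by rewrite sumr_const card_ord mulr_natl.
  apply: ler_sum => u' _.
  have h' : ((v + u') + l <= N)%N by have := ltn_ord u'; lia.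
  have := sum_ord_ge (f := fun u => q (e *+ u - e *+ u')) (fun i => q0 _) h'.
  apply: le_trans; rewrite le_eqVlt; apply/orP; left; apply/eqP.
  apply: eq_bigr => i _.
  by rewrite addnAC [e *+ (v + i + u')]mulrnDr addrK.
apply: (sum_ord_ge (f := fun u' => \sum_(u < N) q (e *+ u - e *+ u')) (m := 0)).
  by move=> i; apply: sumr_ge0.
lia.
Qed.

(** [difference_cover] in both directions gives each point of the small grid at least [l ^+ 2]
    representations as a difference; the factor [P ^+ 4] is the ratio of the normalizations
    [(l * P) ^+ 4] and [l ^+ 4]. *)
Lemma grid_domination e1 e2 l P (v1 v2 : nat) q : (forall x, 0 <= q x) ->
  (0 < l)%N -> (0 < P)%N -> (v1 + 2 * l <= l * P)%N -> (v2 + 2 * l <= l * P)%N ->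
  expect (grid e1 e2 l) (fun y => q (e1 *+ v1 + e2 *+ v2 + y)) <=
  P%:R ^+ 4 * expect (conv (grid e1 e2 (l * P)) (refl (grid e1 e2 (l * P)))) q.
Proof.
move=> q0 l0 P0 h1 h2; set N := (l * P)%N.
have l0' : 0 < l%:R :> R by rewrite ltr0n.
have P0' : 0 < P%:R :> R by rewrite ltr0n.
have NE : N%:R = l%:R * P%:R :> R by rewrite natrM.
pose S := \sum_(i < l) \sum_(j < l) q (e1 *+ (v1 + i) + e2 *+ (v2 + j)).
pose W := \sum_(v < N) \sum_(v' < N) \sum_(u < N) \sum_(u' < N)
  q ((e1 *+ u - e1 *+ u') + (e2 *+ v - e2 *+ v')).
have eS : expect (grid e1 e2 l) (fun y => q (e1 *+ v1 + e2 *+ v2 + y)) = S / l%:R ^+ 2.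
  rewrite expect_grid; congr (_ / _); apply: eq_bigr => i _; apply: eq_bigr => j _.
  by rewrite !mulrnDr addrACA.
have eW : expect (conv (grid e1 e2 N) (refl (grid e1 e2 N))) q = W / N%:R ^+ 4.
  rewrite expect_conv expect_grid.
  have -> : \sum_(u < N) \sum_(v < N) expect (refl (grid e1 e2 N))
      (fun y => q (e1 *+ u + e2 *+ v + y)) =
    \sum_(u < N) \sum_(v < N) (\sum_(u' < N) \sum_(v' < N)
       q ((e1 *+ u - e1 *+ u') + (e2 *+ v - e2 *+ v'))) / N%:R ^+ 2.
    apply: eq_bigr => u _; apply: eq_bigr => v _.
    rewrite expect_refl expect_grid; congr (_ / _); apply: eq_bigr => u' _.
    by apply: eq_bigr => v' _; rewrite opprD addrACA.
  have -> : \sum_(u < N) \sum_(v < N) (\sum_(u' < N) \sum_(v' < N)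
       q ((e1 *+ u - e1 *+ u') + (e2 *+ v - e2 *+ v'))) / N%:R ^+ 2 = W / N%:R ^+ 2.
    rewrite /W exchange_big mulr_suml; apply: eq_bigr => v _.
    rewrite -mulr_suml; congr (_ / _); rewrite [RHS]exchange_big.
    by apply: eq_bigr => u _; rewrite exchange_big.
  by rewrite -mulrA -invfM -exprD.
have key : l%:R ^+ 2 * S <= W.
  apply: (@le_trans _ _ (\sum_(v < N) \sum_(v' < N) l%:R * \sum_(i < l)
      q (e1 *+ (v1 + i) + (e2 *+ v - e2 *+ v')))); last first.
    apply: ler_sum => v _; apply: ler_sum => v' _.
    by apply: (difference_cover e1 (q := fun x => q (x + (e2 *+ v - e2 *+ v')))).
  under [leRHS]eq_bigr do rewrite -mulr_sumr.
  rewrite -mulr_sumr expr2 -mulrA ler_wpM2l ?ler0n//.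
  under [leRHS]eq_bigr do rewrite exchange_big.
  rewrite [leRHS]exchange_big/= mulr_sumr; apply: ler_sum => i _.
  exact: (difference_cover e2 (q := fun x => q (e1 *+ (v1 + i) + x))).
rewrite eS eW.
have -> : P%:R ^+ 4 * (W / N%:R ^+ 4) = W / l%:R ^+ 4.
  by rewrite NE; field; rewrite !gt_eqF.
have -> : S / l%:R ^+ 2 = l%:R ^+ 2 * S / l%:R ^+ 4.
  by field; rewrite gt_eqF.
by rewrite ler_pM2r// invr_gt0 exprn_gt0.
Qed.

Lemma autoconv_grid_shift e1 e2 N F (v1 v2 : nat) : (0 < N)%N -> unitval F ->
  `|expect (conv (grid e1 e2 N) (refl (grid e1 e2 N)))
      (fun w => corr F (e1 *+ v1 + e2 *+ v2 + w)) -
    qform (conv (grid e1 e2 N) (refl (grid e1 e2 N))) F| <= (v1 + v2)%:R / N%:R.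
Proof.
move=> N0 hF; have pg := prob_grid e1 e2 N0.
rewrite /qform !expect_conv.
under eq_expect do rewrite expect_refl.
under [X in _ - X]eq_expect do rewrite expect_refl.
rewrite expect_swap [X in _ - X]expect_swap -expectB.
apply: normr_expect_le => // y _.
have hq : unitval (fun x => corr F (x - y)) by move=> x; exact: unitval_corr.
apply: le_trans (grid_shift e1 e2 v1 v2 N0 hq).
rewrite le_eqVlt; apply/orP; left; apply/eqP; congr (`|_ - _|).
by apply: eq_expect => x; rewrite addrA [X in corr F (X - _)]addrC.
Qed.

Lemma qform_autoconv0 c F :
  qform (conv c (refl c)) F = corr (fun x => expect c (fun u => F (x + u))) 0.
Proof.
rewrite corr_expect /qform expect_conv; apply: eq_expect => v.
by rewrite expect_refl; apply: eq_expect => u; rewrite addr0.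
Qed.

Definition autoconv c : G -> R := conv c (refl c).

Lemma prob_autoconv c : prob c -> prob (autoconv c).
Proof. by move=> pc; apply: prob_conv => //; exact: prob_refl. Qed.

Lemma expect_autoconv_conv c p q :
  expect (autoconv (conv c p)) q = expect (conv (autoconv c) (autoconv p)) q.
Proof.
rewrite !expect_conv; apply: eq_expect => x.
under [RHS]eq_expect do rewrite expect_conv.
rewrite expect_refl; under [RHS]eq_expect do under eq_expect do rewrite expect_refl.
rewrite [RHS]expect_swap; apply: eq_expect => y.
rewrite expect_refl expect_conv; apply: eq_expect => x'; apply: eq_expect => y'.
by rewrite opprD addrACA.
Qed.

(* One scale of one coordinate: T averages over (a thickening of) an arc of
   radius rho, s and h are smoothings at scales much smaller and much larger
   than rho, and mu is T smoothed at a scale slightly below rho. *)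
Definition scale_step (C eta : R) (T mu s h : G -> R) : Prop :=
  [/\ prob T, prob mu, prob s & prob h] /\
  [/\ forall F, unitval F -> qform mu F <= qform T F + eta,
      forall F, unitval F -> qform h F <= qform mu F + (qform s F - qform h F) + eta,
      forall F, qform h F <= qform s F,
      forall F, mean F ^+ 2 <= qform h F &
      forall q, (forall x, 0 <= q x) -> expect mu q <= C * expect h q].

(** The coarse smoothings are built cumulatively, so that each one is exactly the previous one
    convolved with one more autoconvolution; this is what makes their forms monotone. *)
Fixpoint iconv (p : nat -> G -> R) (j : nat) : G -> R :=
  if j is j'.+1 then conv (iconv p j') (p j') else dirac0.

Lemma prob_iconv (p : nat -> G -> R) j : (forall i, prob (p i)) -> prob (iconv p j).
Proof.
by move=> h; elim: j => [|j IH]; [exact: prob_dirac0|exact: prob_conv].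
Qed.

Definition reach e1 e2 (n : R) (x : G) : Prop :=
  exists u v : nat, [/\ u%:R <= n, v%:R <= n & x = e1 *+ u + e2 *+ v].

Lemma reachD e1 e2 (n m : R) x y : reach e1 e2 n x -> reach e1 e2 m y ->
  reach e1 e2 (n + m) (x + y).
Proof.
move=> [u [v [h1 h2 ->]]] [u' [v' [h3 h4 ->]]]; exists (u + u')%N, (v + v')%N.
by rewrite !natrD !lerD// !mulrnDr addrACA.
Qed.

Lemma grid_reach e1 e2 l x : grid e1 e2 l x != 0 -> reach e1 e2 l%:R x.
Proof.
by move=> /unif_neq0[[u v] ->]; exists u, v; rewrite !ler_nat !(ltnW (ltn_ord _)).
Qed.

End Grid.

Lemma coordinate_scales {R : realType} (eta : R) : 0 < eta ->
  exists b : R, exists k : nat, exists C : R, exists Lam : R, exists rho1 : R,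
  [/\ 0 < b <= 1, (0 < k)%N, 1 <= C, 1 <= Lam & 1 <= rho1 /\ 1 <= b * rho1] /\
  forall (G : finZmodType) (e1 e2 : G) (rho : nat -> R),
    rho1 <= rho 0%N -> (forall j, Lam * rho j <= rho j.+1) ->
    exists s mu : nat -> G -> R, forall j,
      scale_step C eta (circle e1 e2 (rho j) (Num.trunc (b * rho j)) k)
        (mu j) (s j) (s j.+1).
Proof.
move=> eta0; have eta4 : 0 < eta / 4 by rewrite divr_gt0.
have [b [k [eps [rs [/andP[b0 b12] k0 eps0 rs1 smoothing]]]]] := circle_smoothing eta4.
(* [P] is the ratio of the sides of the coarse and fine grids. The arc reaches at most
   [2 * rho <= 8 / eps * l], so [8 / eps + 2] is what [grid_domination] needs; the last summand
   makes a shift of the coarse grid by a point of the smoothed arc cost at most [eta]. *)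
pose P := (Num.trunc (8 / eps + 3 + 2 * (8 / eps + 1) / eta)).+1.
have eps8 : 0 < 8 / eps by rewrite divr_gt0.
have PP : 8 / eps + 3 + 2 * (8 / eps + 1) / eta < P%:R by exact: truncnS_gt.
have P' : 0 < 2 * (8 / eps + 1) / eta by rewrite divr_gt0// mulr_gt0//; lra.
have P0 : (0 < P)%N by [].
have P1 : 1 <= P%:R :> R by rewrite ler1n.
exists b, k, (P%:R ^+ 4), (1 + P%:R), (rs + k%:R + 8 / eps + b^-1).
have bV : 0 < b^-1 by rewrite invr_gt0.
have k0' : 0 < k%:R :> R by rewrite ltr0n.
split.
  split => //; [lra | exact: exprn_ege1 | lra | split; first by lra].
  by rewrite -ler_pdivrMl// mulr1; lra.
move=> G e1 e2 rho rho0 rhoS.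
have rho_ge j : rs + k%:R + 8 / eps + b^-1 <= rho j.
  elim: j => // j IH; apply: (le_trans IH); apply: le_trans (rhoS j).
  by rewrite ler_peMl; lra.
pose l j := (Num.trunc (eps / 4 * rho j)).+1.
pose g j := grid e1 e2 (l j * P)%N : G -> R.
pose c := iconv g.
pose T j := circle e1 e2 (rho j) (Num.trunc (b * rho j)) k : G -> R.
pose s j := autoconv (c j).
pose mu j := conv (s j) (conv (T j) (grid e1 e2 (l j))).
exists s, mu => j.
have pg i : prob (g i) by apply: prob_grid; rewrite muln_gt0.
have pc i : prob (c i) by exact: prob_iconv.
have ps i : prob (s i) by exact: prob_autoconv.
have pgl i : prob (grid e1 e2 (l i) : G -> R) by exact: prob_grid.
have rho_gt0 i : 0 < rho i by have := rho_ge i; lra.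
have rho_rs i : rs <= rho i by have := rho_ge i; lra.
have rho_k i : k%:R <= rho i by have := rho_ge i; lra.
have eps_rho i : 8 <= eps * rho i.
  by have : 8 / eps <= rho i by [have := rho_ge i; lra]; rewrite ler_pdivrMr// mulrC.
have lge i : eps / 4 * rho i <= (l i)%:R by rewrite ltW// truncnS_gt.
have lle i : (l i)%:R <= eps / 2 * rho i.
  have h : (l i)%:R <= eps / 4 * rho i + 1.
    by rewrite /l -[X in X <= _]natr1 lerD2r truncn_le mulr_ge0// ltW// divr_gt0.
  by apply: (le_trans h); have := eps_rho i; lra.
have K0 : (0 < Num.trunc (b * rho j))%N.
  have /(_ G e1 e2 (fun=> 0) (rho j) 0 0%N) := smoothing.
  case=> //; first by move=> x; rewrite lexx ler01.
  by rewrite mulr_ge0// ltW.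
have pT : prob (T j) by exact: prob_circle.
(* All earlier scales together stay below the current one: the new grid adds at most
   [P * (eps / 2 * rho i)], and [Lam = 1 + P]. *)
have reach_c i x : c i x != 0 -> reach e1 e2 (eps / 2 * rho i) x.
  elim: i x => [|i IH] x.
    rewrite /c /= /dirac0 pnatr_eq0 eqb0 negbK => /eqP ->; exists 0%N, 0%N.
    by rewrite addr0 !mulr_ge0 ?invr_ge0// ltW.
  move=> /conv_neq0[y [z [/IH hy /grid_reach hz ->]]].
  have [u [v [h1 h2 h3]]] := reachD hy hz.
  exists u, v; split => //; [apply: (le_trans h1)|apply: (le_trans h2)];
  rewrite natrM;
  have := ler_wpM2r (ltW (lt_le_trans ltr01 P1)) (lle i);
  have := ler_wpM2l (ltW (divr_gt0 eps0 (ltr0n R 2))) (rhoS i); lra.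
have reach_T v : T j v != 0 -> reach e1 e2 (2 * rho j) v.
  move=> /unif_neq0[[y u] /= ->]; exists (Num.trunc (arc_height (rho j) y) + u)%N, (y : nat).
  split => //.
    have h1 : (Num.trunc (arc_height (rho j) y))%:R <= rho j.
      by apply: le_trans (arc_le y (ltW (rho_gt0 j))); rewrite truncn_le arc_ge0.
    have h2 : u%:R <= k%:R :> R by rewrite ler_nat ltnW.
    by rewrite natrD; have := rho_k j; lra.
  have h1 : y%:R <= (Num.trunc (b * rho j))%:R :> R by rewrite ler_nat ltnW.
  have h2 : (Num.trunc (b * rho j))%:R <= b * rho j by rewrite truncn_le mulr_ge0// ltW.
  have h3 : b * rho j <= rho j by rewrite ler_piMl ?(ltW (rho_gt0 j))//; lra.
  have := rho_gt0 j; lra.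
have l0 : 0 < (l j)%:R :> R by rewrite ltr0n.
have rho_l : 2 * rho j <= 8 / eps * (l j)%:R.
  have -> : 2 * rho j = 8 / eps * (eps / 4 * rho j) by field; rewrite gt_eqF.
  by rewrite ler_wpM2l// ltW.
have hE q : expect (s j.+1) q = expect (conv (s j) (autoconv (g j))) q.
  exact: expect_autoconv_conv.
split; first by split => //; apply: prob_conv => //; exact: prob_conv.
split.
- move=> F hF; pose B := circle_corr e1 e2 (rho j) (Num.trunc (b * rho j)) k F.
  have B1 z (u : nat) : u%:R <= eps * rho j -> `|B z - B (z + e1 *+ u)| <= eta / 4.
    by move=> hu; have [] := smoothing G e1 e2 F (rho j) z u hF (rho_rs j) hu.
  have B2 z (u : nat) : u%:R <= eps * rho j -> `|B z - B (z + e2 *+ u)| <= eta / 4.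
    by move=> hu; have [] := smoothing G e1 e2 F (rho j) z u hF (rho_rs j) hu.
  have -> : qform (mu j) F =
      expect (s j) (fun x => expect (grid e1 e2 (l j)) (fun y => B (x + y))).
    rewrite /qform expect_conv; apply: eq_expect => x; rewrite expect_conv expect_swap.
    by apply: eq_expect => y; apply: eq_expect => v; rewrite addrCA.
  have -> : qform (T j) F = B 0 by apply: eq_expect => v; rewrite addr0.
  rewrite -(expect_cst (B 0 + eta) (ps j)); apply: le_expect (ps j).1 _ => x sx.
  rewrite -(expect_cst (B 0 + eta) (pgl j)); apply: le_expect (pgl j).1 _ => y gy.
  have [x1 [x2 [cx1 cx2 ->]]] := conv_neq0 sx.
  have [p [q [hp hq e]]] := reachD (reach_c _ _ cx1) (grid_reach gy).
  have [p' [q' [hp' hq' e']]] := reach_c _ _ cx2.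
  have -> : x1 + x2 + y = x1 + y + x2 by rewrite addrAC.
  rewrite e -[x2]opprK e'; have := lle j => hl.
  have er0 : 0 <= eps * rho j by rewrite mulr_ge0// ltW.
  (* The point is joined to 0 by four shifts of at most [eps * rho j] steps, two forward and two
     backward, each costing [eta / 4]. *)
  have := B1 (e1 *+ p + e2 *+ q - (e1 *+ p' + e2 *+ q')) p' ltac:(lra).
  rewrite opprD addrA addrAC subrK.
  have := B2 (e1 *+ p + e2 *+ q - e2 *+ q') q' ltac:(lra); rewrite subrK.
  have := B2 (e1 *+ p) q ltac:(lra); have := B1 0 p ltac:(lra); rewrite add0r.
  rewrite !ler_norml => /andP[? ?] /andP[? ?] /andP[? ?] /andP[? ?]; lra.
(* Absorbing [c j] into [F'] turns the form of [s j] into [corr F' 0], and only the single coarse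
   grid [g j] is left to compare with the arc. *)
- move=> F hF; pose F' := fun x => expect (c j) (fun u => F (x + u)).
  have hF' : unitval F' by exact: unitval_expect.
  have -> : qform (s j.+1) F = qform (autoconv (g j)) F' by rewrite {1}/qform hE -qform_autoconv.
  rewrite (qform_autoconv0 (c j) F) -/F'.
  have -> : qform (mu j) F = qform (conv (T j) (grid e1 e2 (l j))) F'.
    exact: qform_autoconv.
  set A := qform (autoconv (g j)) F'.
  suff : A - (corr F' 0 - A) - eta <= qform (conv (T j) (grid e1 e2 (l j))) F' by lra.
  rewrite /qform expect_conv -(expect_cst (A - _ - _) pT); apply: le_expect pT.1 _ => v Tv.
  rewrite -(expect_cst (A - _ - _) (pgl j)); apply: le_expect (pgl j).1 _ => y gy.
  have [p [q [hp hq ->]]] := reachD (reach_T _ Tv) (grid_reach gy).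
  have N0 : (0 < l j * P)%N by rewrite muln_gt0.
  have h := autoconv_grid_shift e1 e2 p q N0 hF'.
  have h2 : A <= corr F' (e1 *+ p + e2 *+ q) + (corr F' 0 - A) +
      (p + q)%:R / (l j * P)%:R := qform_autoconv_shift (pg j) h.
  suff : (p + q)%:R / (l j * P)%:R <= eta.
    by move: h2; lra.
  rewrite ler_pdivrMr ?ltr0n// natrD natrM.
  have h3 : 2 * (8 / eps + 1) <= eta * P%:R.
    by rewrite [eta * _]mulrC -ler_pdivrMr// (le_trans _ (ltW PP))//; lra.
  have h4 : 2 * (8 / eps + 1) * (l j)%:R <= eta * P%:R * (l j)%:R by rewrite ler_wpM2r// ltW.
  lra.
- by move=> F; rewrite {1}/qform hE; exact: qform_autoconv_le (prob_autoconv (pg j)).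
- by move=> F; apply: qform_autoconv_ge.
- move=> q q0; rewrite hE /mu (expect_conv (s j)) [in leRHS](expect_conv (s j)) -expectZ; apply: le_expect (ps j).1 _ => x _.
  rewrite expect_conv -[leRHS](expect_cst _ pT); apply: le_expect pT.1 _ => v Tv.
  have [v1 [v2 [h1 h2 ->]]] := reach_T _ Tv.
  have hv (i : nat) : i%:R <= 2 * rho j -> (i + 2 * l j <= l j * P)%N.
    move=> hi; rewrite -(ler_nat R) natrD !natrM.
    have : (8 / eps + 2) * (l j)%:R <= P%:R * (l j)%:R.
      by rewrite ler_wpM2r ?(ltW l0)//; lra.
    lra.
  exact: (grid_domination e1 e2 (q := fun w => q (x + w)) (fun w => q0 _) _ P0
    (hv _ h1) (hv _ h2)).
Qed.

(** * Counting parallelepipeds *)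

Section BoxCount.
Context {R : realType} {G : finZmodType}.
Implicit Types (F f p q : G -> R) (Phi Psi : (G -> R) -> R) (ps : seq (G -> R)).

Definition shiftM f s : G -> R := fun x => f x * f (x + s).

(* Average of Phi over the products of f over the vertices of random
   parallelepipeds with edges distributed according to ps. *)
Fixpoint wcount Phi ps f : R :=
  if ps is p :: ps' then expect p (fun s => wcount Phi ps' (shiftM f s)) else Phi f.

Fixpoint all_prob ps : Prop := if ps is p :: ps' then prob p /\ all_prob ps' else True.

Lemma all_prob_cat ps ps' : all_prob ps -> all_prob ps' -> all_prob (ps ++ ps').
Proof. by move=> h h'; elim: ps h => //= p ps IH [pp /IH]. Qed.

Lemma all_prob_map (I : Type) (p : I -> G -> R) (r : seq I) :
  (forall i, prob (p i)) -> all_prob (map p r).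
Proof. by move=> h; elim: r => //= i r IH; split. Qed.

Lemma shiftMC f s t : shiftM (shiftM f s) t = shiftM (shiftM f t) s.
Proof. by apply/funext => x; rewrite /shiftM mulrACA [x + t + s]addrAC. Qed.

Lemma unitval_shift f s : unitval f -> unitval (shiftM f s).
Proof. exact: unitval_shiftM. Qed.

Lemma wcountD Phi Psi ps f :
  wcount (fun F => Phi F + Psi F) ps f = wcount Phi ps f + wcount Psi ps f.
Proof.
elim: ps f => //= p ps IH f; rewrite -expectD.
by apply: eq_expect => s; rewrite IH.
Qed.

Lemma wcountB Phi Psi ps f :
  wcount (fun F => Phi F - Psi F) ps f = wcount Phi ps f - wcount Psi ps f.
Proof.
elim: ps f => //= p ps IH f; rewrite -expectB.
by apply: eq_expect => s; rewrite IH.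
Qed.

Lemma wcount_cst c ps f : all_prob ps -> wcount (fun=> c) ps f = c.
Proof.
elim: ps f => //= p ps IH f [pp /IH h]; rewrite -[RHS](expect_cst c pp).
by apply: eq_expect => s; rewrite h.
Qed.

Lemma le_wcount Phi Psi ps f : all_prob ps -> unitval f ->
  (forall F, unitval F -> Phi F <= Psi F) -> wcount Phi ps f <= wcount Psi ps f.
Proof.
move=> + + h; elim: ps f => [|p ps IH] f /=; first by move=> _; exact: h.
move=> [pp /IH IH'] hf; apply: le_expect pp.1 _ => s _.
exact: IH' (unitval_shift _ hf).
Qed.

Lemma wcount_ge0 Phi ps f : all_prob ps -> unitval f ->
  (forall F, unitval F -> 0 <= Phi F) -> 0 <= wcount Phi ps f.
Proof.
by move=> hp hf h; rewrite -(wcount_cst 0 f hp); exact: le_wcount.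
Qed.

Lemma wcount_pull Phi p ps f :
  wcount Phi (p :: ps) f = wcount (fun F => expect p (fun s => Phi (shiftM F s))) ps f.
Proof.
elim: ps f => //= q ps IH f; rewrite expect_swap; apply: eq_expect => t.
by rewrite -IH /=; apply: eq_expect => s; rewrite shiftMC.
Qed.

Lemma wcount_cat Phi ps ps' f :
  wcount Phi (ps ++ ps') f = wcount (wcount Phi ps') ps f.
Proof. by elim: ps f => //= p ps IH f; apply: eq_expect => s; rewrite IH. Qed.

(** The order of the edges is immaterial, so the count is a quadratic form in each edge law
    separately, applied to the product over the vertices spanned by the other edges. *)
Lemma wcount_mean_split p ps ps' f :
  wcount mean (ps ++ p :: ps') f = wcount (qform p) (ps ++ ps') f.
Proof.
rewrite !wcount_cat; congr (wcount _ ps f); apply/funext => F.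
by rewrite wcount_pull.
Qed.

Lemma wcount_dominated (C : R) Phi (I : Type) (p q : I -> G -> R) (r : seq I) ps f :
  0 <= C -> (forall i, prob (p i)) -> (forall i, prob (q i)) -> all_prob ps ->
  (forall i (F : G -> R), (forall x, 0 <= F x) -> expect (p i) F <= C * expect (q i) F) ->
  (forall F, unitval F -> 0 <= Phi F) -> unitval f ->
  wcount Phi (map p r ++ ps) f <= C ^+ size r * wcount Phi (map q r ++ ps) f.
Proof.
move=> C0 hp hq hps hC h0; elim: r f => [|i r IH] f hf /=; first by rewrite mul1r.
apply: (@le_trans _ _ (C * expect (q i)
    (fun s => wcount Phi ([seq p i | i <- r] ++ ps) (shiftM f s)))).
  apply: hC => s; apply: wcount_ge0 (unitval_shift _ hf) h0.
  by apply: all_prob_cat hps; exact: all_prob_map.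
rewrite exprS -mulrA ler_wpM2l// -expectZ; apply: le_expect (hq i).1 _ => s _.
exact: IH (unitval_shift _ hf).
Qed.

Lemma wcount_mean_le (I : Type) (p q : I -> G -> R) (r : seq I) ps ps' f :
  (forall i, prob (p i)) -> (forall i, prob (q i)) -> all_prob ps -> all_prob ps' ->
  (forall i F, unitval F -> qform (p i) F <= qform (q i) F) -> unitval f ->
  wcount mean (ps ++ map p r ++ ps') f <= wcount mean (ps ++ map q r ++ ps') f.
Proof.
move=> hp hq hps hps' h hf; rewrite wcount_cat [leRHS]wcount_cat.
apply: le_wcount => // F hF; elim: r F hF => //= i r IH F hF.
have := wcount_mean_split (p i) [::] ([seq p i | i <- r] ++ ps') F => /= ->.
apply: (@le_trans _ _ (wcount (qform (q i)) ([seq p i | i <- r] ++ ps') F)).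
  apply: le_wcount => //; last by exact: h.
  by apply: all_prob_cat hps'; exact: all_prob_map.
have := wcount_mean_split (q i) [::] ([seq p i | i <- r] ++ ps') F => /= <-.
apply: le_expect (hq i).1 _ => s _; exact: IH (unitval_shift _ hF).
Qed.

Lemma expect_pow2 p F k : prob p -> nonneg F ->
  (expect p F) ^+ (2 ^ k) <= expect p (fun x => F x ^+ (2 ^ k)).
Proof.
move=> pp F0; elim: k => [|k IH]; first by rewrite expr1; under [leRHS]eq_expect do rewrite expr1.
rewrite expnSr exprM; apply: (@le_trans _ _ (expect p (fun x => F x ^+ (2 ^ k)) ^+ 2)).
  rewrite lerXn2r// nnegrE ?exprn_ge0 ?expect_ge0//; try exact: pp.1.
  by move=> x; rewrite exprn_ge0.
apply: (le_trans (cauchy_expect _ pp)); rewrite le_eqVlt; apply/orP; left; apply/eqP.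
by apply: eq_expect => x; rewrite exprM.
Qed.

(** Each edge at least squares the mean; convexity of the powers [2 ^ k] carries this through the
    induction. *)
Lemma wcount_mean_ge (I : Type) (h : I -> G -> R) (r : seq I) f :
  (forall i, prob (h i)) -> (forall i F, mean F ^+ 2 <= qform (h i) F) -> unitval f ->
  mean f ^+ (2 ^ size r) <= wcount mean (map h r) f.
Proof.
move=> hp hh; elim: r f => [|i r IH] f hf /=; first by rewrite expr1.
apply: (@le_trans _ _ (expect (h i) (fun s => mean (shiftM f s) ^+ (2 ^ size r)))).
  apply: le_trans (expect_pow2 _ (hp i) _); last first.
    by move=> s; case/andP: (unitval_mean (unitval_shift s hf)).
  have E0 : 0 <= expect (h i) (fun s => mean (shiftM f s)).
    apply: expect_ge0; first exact: (hp i).1.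
    by move=> s; case/andP: (unitval_mean (unitval_shift s hf)).
  by rewrite expnS exprM lerXn2r ?nnegrE ?sqr_ge0//; exact: hh.
by apply: le_expect (hp i).1 _ => s _; exact: IH (unitval_shift _ hf).
Qed.

(** The replacement has two stages because only [mu], not [T], is dominated by [h]: all arcs are
    smoothed before any coordinate is passed to [h]. The lemma is stated with [h] and [s] evaluated
    on the full count, the only quantities that telescope. *)
Lemma wcount_scale_step (I : Type) (C eta : R) (T mu s h : I -> G -> R) (r : seq I) f :
  0 <= eta -> 1 <= C -> (forall i, scale_step C eta (T i) (mu i) (s i) (h i)) -> unitval f ->
  mean f ^+ (2 ^ size r) <= wcount mean (map T r) f +
    (size r)%:R * (2 * eta + C ^+ size r *
      (wcount mean (map s r) f - wcount mean (map h r) f)).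
Proof.
move=> eta0 C1 st hf.
have pT i : prob (T i) by case: (st i) => -[].
have pmu i : prob (mu i) by case: (st i) => -[].
have ps i : prob (s i) by case: (st i) => -[].
have ph i : prob (h i) by case: (st i) => -[].
have C0 : 0 <= C by lra.
have apm (p : I -> G -> R) r' : (forall i, prob (p i)) -> all_prob (map p r').
  by move=> ?; exact: all_prob_map.
have le_hs i F : unitval F -> qform (h i) F <= qform (s i) F.
  by case: (st i) => _ [].
set D := wcount mean (map s r) f - wcount mean (map h r) f.
have D0 : 0 <= D.
  rewrite subr_ge0; have := @wcount_mean_le I h s r [::] [::] f ph ps.
  by rewrite /= !cats0; apply.
have s1 r1 r2 : wcount mean (map T r1 ++ map mu r2) f <=
    wcount mean (map T (r1 ++ r2)) f + (size r2)%:R * eta.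
  elim: r2 r1 => [|i r2 IH] r1; first by rewrite !cats0 mul0r addr0.
  rewrite /= wcount_mean_split.
  apply: (@le_trans _ _ (wcount (fun F => qform (T i) F + eta) (map T r1 ++ map mu r2) f)).
    apply: le_wcount => //; first by apply: all_prob_cat; exact: apm.
    by case: (st i) => _ [].
  rewrite wcountD wcount_cst; last by apply: all_prob_cat; exact: apm.
  rewrite -wcount_mean_split -cat_rcons -map_rcons -cat_rcons.
  by have := IH (rcons r1 i); rewrite -natr1; lra.
have s2 r1 r2 : r1 ++ r2 = r -> wcount mean (map mu r1 ++ map h r2) f <=
    wcount mean (map mu r) f + (size r2)%:R * (eta + C ^+ size r * D).
  elim: r2 r1 => [|i r2 IH] r1 e; first by rewrite -e !cats0 mul0r addr0.
  have ap1 : all_prob (map mu r1 ++ map h r2) by apply: all_prob_cat; exact: apm.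
  rewrite /= wcount_mean_split.
  apply: (@le_trans _ _ (wcount (fun F => qform (mu i) F + (qform (s i) F - qform (h i) F) + eta)
      (map mu r1 ++ map h r2) f)).
    by apply: le_wcount => //; case: (st i) => _ [].
  rewrite wcountD wcountD (wcount_cst _ _ ap1) -wcount_mean_split -cat_rcons -map_rcons.
  have := IH (rcons r1 i); rewrite cat_rcons => /(_ e).
  have hQ F : unitval F -> 0 <= qform (s i) F - qform (h i) F by move=> /le_hs; rewrite subr_ge0.
  (* The form is nonnegative, so the edges [mu] may be enlarged to [C * h]. The count with [s] in
     place [i] and [h] elsewhere is then at most the count with [s] everywhere. *)
  have dom : wcount (fun F => qform (s i) F - qform (h i) F) (map mu r1 ++ map h r2) f <=
      C ^+ size r * D.
    apply: (@le_trans _ _ (C ^+ size r1 *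
        wcount (fun F => qform (s i) F - qform (h i) F) (map h r1 ++ map h r2) f)).
      apply: wcount_dominated => //; first exact: apm.
      by move=> j F F0; case: (st j) => _ [_ _ _ _]; exact.
    have W0 : 0 <= wcount (fun F => qform (s i) F - qform (h i) F) (map h r1 ++ map h r2) f.
      by apply: wcount_ge0 => //; apply: all_prob_cat; exact: apm.
    apply: ler_pM => //; first exact: exprn_ge0.
      by rewrite -e size_cat exprD ler_peMr ?exprn_ge0// exprn_ege1.
    rewrite wcountB -!wcount_mean_split /D -e map_cat/= [map h (r1 ++ _)]map_cat/= lerB//.
    apply: (@le_trans _ _ (wcount mean (map s r1 ++ s i :: map h r2) f)).
      apply: (@wcount_mean_le I h s r1 [::]) => //=; split => //; exact: apm.
    have := @wcount_mean_le I h s r2 (map s r1 ++ [:: s i]) [::] f ph ps.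
    rewrite !cats0 -!catA /=; apply => //.
    by apply: all_prob_cat => //; exact: apm.
  rewrite -[(size r2).+1%:R]natr1 [(_ + 1) * _]mulrDl mul1r.
  by move: dom; lra.
have := s2 [::] r erefl; have := s1 [::] r; rewrite /=.
have : mean f ^+ (2 ^ size r) <= wcount mean (map h r) f.
  by apply: wcount_mean_ge => // i F; case: (st i) => _ [].
lra.
Qed.

End BoxCount.

(** * Selecting one good scale among boundedly many *)

Lemma telescope_small {R : realType} (a : nat -> R) (J : nat) : (0 < J)%N ->
  (forall j, 0 <= a j) -> a 0%N <= 1 -> exists2 j, (j < J)%N & a j - a j.+1 <= J%:R^-1.
Proof.
case: J => // J _ a0 a1; apply: contrapT => h.
have step j : (j < J.+1)%N -> a j.+1 < a j - J.+1%:R^-1.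
  move=> jJ; rewrite ltNge; apply/negP => h'; apply: h; exists j => //.
  by rewrite lerBlDl -lerBlDr.
have le m : (m <= J)%N -> a m <= a 0%N - m%:R / J.+1%:R.
  elim: m => [|m IH] mJ; first by rewrite mul0r subr0.
  have e : m.+1%:R / J.+1%:R = m%:R / J.+1%:R + J.+1%:R^-1 :> R.
    by rewrite -[m.+1%:R]natr1 [LHS]mulrDl mul1r.
  rewrite e opprD addrA; apply: (le_trans (ltW (step m (ltnW mJ)))).
  by rewrite lerD2r; exact: IH (ltnW mJ).
have e : J%:R / J.+1%:R + J.+1%:R^-1 = 1 :> R.
  by rewrite -{2}[J.+1%:R^-1]mul1r -mulrDl natr1 divff// pnatr_eq0.
have h1 := step J (ltnSn J); have h2 := le J (leqnn J).
have h3 := lt_le_trans h1 (lerB h2 (lexx J.+1%:R^-1)).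
move: (a0 J.+1); apply/negP; rewrite -ltNge (lt_le_trans h3)//.
by rewrite -addrA -opprD e subr_le0.
Qed.

(** Only the good index [j] depends on the group, the function and the radii; [J] and [c] do not. *)
Lemma box_count_large {R : realType} (n : nat) (delta : R) : 0 < delta ->
  exists b : R, exists k : nat, exists Lam : R, exists rho1 : R, exists J : nat,
  exists c : R, [/\ 0 < b <= 1, (0 < k)%N, 1 <= Lam, 1 <= rho1 /\ 1 <= b * rho1 & 0 < c] /\
  forall (G : finZmodType) (e1 e2 : 'I_n -> G) (rho : 'I_n -> nat -> R) (f : G -> R),
    (forall i, rho1 <= rho i 0%N) -> (forall i j, Lam * rho i j <= rho i j.+1) ->
    unitval f -> delta <= mean f ->
    exists2 j, (j < J)%N &
      c <= wcount mean [seq circle (e1 i) (e2 i) (rho i j) (Num.trunc (b * rho i j)) k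
                       | i <- enum 'I_n] f.
Proof.
move=> delta0; pose c := delta ^+ (2 ^ n) / 2.
have c0 : 0 < c by rewrite divr_gt0// exprn_gt0.
(* Half of the main term [2 * c] may be lost: [c / 2] to the [2 * n] errors [eta], and [c / 2] to
   the telescoping term through the choice of [J]. Using [n.+1] keeps [eta] positive for [n = 0]. *)
pose eta := c / (4 * n.+1%:R).
have n0 : 0 < n.+1%:R :> R by rewrite ltr0n.
have eta0 : 0 < eta by rewrite divr_gt0// mulr_gt0.
have [b [k [C [Lam [rho1 [[b0 k0 C1 Lam1 rho11] H]]]]]] := coordinate_scales eta0.
pose J := (Num.trunc (2 * n.+1%:R * C ^+ n / c)).+1.
exists b, k, Lam, rho1, J, c; split => // G e1 e2 rho f h0 hS hf hd.
have [s /choice[mu st]] := choice (fun i => H G (e1 i) (e2 i) (rho i) (h0 i) (hS i)).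
pose a j := wcount mean [seq s i j | i <- enum 'I_n] f.
have ps i j : prob (s i j) by case: (st i j) => -[].
have ap j : all_prob [seq s i j | i <- enum 'I_n] by exact: all_prob_map.
have a_ge0 j : 0 <= a j.
  by apply: wcount_ge0 => // F hF; case/andP: (unitval_mean hF).
have a_le1 : a 0%N <= 1.
  rewrite -(wcount_cst 1 f (ap 0%N)); apply: le_wcount => // F hF.
  by case/andP: (unitval_mean hF).
have [j jJ hj] := @telescope_small R a J (ltn0Sn _) a_ge0 a_le1.
exists j => //.
have := @wcount_scale_step R G 'I_n C eta _ _ _ _ (enum 'I_n) f (ltW eta0) C1
  (fun i => st i j) hf.
rewrite -/(a j) -/(a j.+1) size_enum_ord.
have hm : delta ^+ (2 ^ n) <= mean f ^+ (2 ^ n).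
  by rewrite lerXn2r// nnegrE ltW// (lt_le_trans delta0).
have e : n%:R * (2 * eta) <= c / 2.
  have -> : c / 2 = n.+1%:R * (2 * eta).
    by rewrite /eta; move: (n.+1%:R : R) n0 => N N0; field; rewrite gt_eqF.
  by apply: ler_wpM2r; [rewrite mulr_ge0// ltW|rewrite ler_nat].
have e' : n%:R * (C ^+ n * (a j - a j.+1)) <= c / 2.
  have J0 : 0 < J%:R :> R by rewrite ltr0n.
  have hJ : 2 * n.+1%:R * C ^+ n / c < J%:R by exact: truncnS_gt.
  have Cn : 0 <= C ^+ n by rewrite exprn_ge0//; lra.
  apply: (@le_trans _ _ (n.+1%:R * (C ^+ n * J%:R^-1))).
    apply: (@le_trans _ _ (n%:R * (C ^+ n * J%:R^-1))).
      by rewrite !ler_wpM2l.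
    by rewrite ler_wpM2r ?mulr_ge0 ?invr_ge0 ?ler0n// ler_nat.
  rewrite mulrA ler_pdivrMr//; move: hJ; rewrite ltr_pdivrMr//; lra.
have -> : c = delta ^+ (2 ^ n) - c by rewrite /c; field.
lra.
Qed.

(** * Lebesgue outer measure *)

Section OuterMeasure.
Context {R : realType} {m : nat}.
Implicit Types (X Y A : set 'rV[R]_m) (a b u v : 'rV[R]_m).

Definition le_corner a b : Prop := forall i, a ord0 i <= b ord0 i.

Lemma box_volume_ge0 a b : le_corner a b -> 0 <= box_volume a b.
Proof. by move=> h; apply: prodr_ge0 => i _; rewrite subr_ge0. Qed.

(** Index types other than [nat] are needed for subadditivity, where the covers are indexed by
    pairs. The corner 0 is a placeholder for codes that encode no index. *)
Lemma lebesgue_mu_le_cover (I : countType) (D : set I) (a b : I -> 'rV[R]_m) X :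
  (forall k, D k -> le_corner (a k) (b k)) ->
  X `<=` \bigcup_(k in D) box (a k) (b k) ->
  (lebesgue_mu X <= \esum_(k in D) (box_volume (a k) (b k))%:E)%E.
Proof.
move=> ab XD; apply: ereal_inf_lbound.
pose e k := oapp a 0 (@choice.unpickle I k); pose e' k := oapp b 0 (@choice.unpickle I k).
exists (choice.pickle @` D), e, e'; split; first split.
- by move=> _ [k Dk <-]; rewrite /e /e' choice.pickleK /=; exact: ab.
- move=> x /XD[k Dk xk]; exists (choice.pickle k); first by exists k.
  by rewrite /e /e' choice.pickleK.
rewrite esum_image; last by move=> x y _ _; exact: (pcan_inj choice.pickleK).
by apply: eq_esum => k Dk; rewrite /e /e' choice.pickleK.
Qed.

Lemma lebesgue_mu_ge0 X : (0 <= lebesgue_mu X)%E.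
Proof.
apply: le_ereal_inf_tmp => _ [D [a [b [[ab _] ->]]]].
by apply: esum_ge0 => k Dk; rewrite lee_fin box_volume_ge0//; exact: ab.
Qed.

Lemma lebesgue_mu0 : lebesgue_mu (set0 : set 'rV[R]_m) = 0%E.
Proof.
apply/eqP; rewrite eq_le lebesgue_mu_ge0 andbT.
have := @lebesgue_mu_le_cover nat set0 (fun=> 0) (fun=> 0) set0.
by rewrite esum_set0; apply.
Qed.

Lemma le_lebesgue_mu : {homo @lebesgue_mu R m : X Y / X `<=` Y >-> (X <= Y)%E}.
Proof.
move=> X Y XY; apply: le_ereal_inf_tmp => _ [D [a [b [[ab YD] ->]]]].
by apply: lebesgue_mu_le_cover => // x /XY /YD.
Qed.

Lemma lebesgue_mu_cover X (e : R) : 0 < e -> (lebesgue_mu X < +oo)%E ->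
  exists (D : set nat) (a b : nat -> 'rV[R]_m), box_cover X D a b /\
    (\esum_(k in D) (box_volume (a k) (b k))%:E <= lebesgue_mu X + e%:E)%E.
Proof.
move=> e0 Xoo.
have Xfin : lebesgue_mu X \is a fin_num by rewrite ge0_fin_numE// lebesgue_mu_ge0.
have [_ [D [a [b [h ->]]]] /ltW h2] := lb_ereal_inf_adherent e0 Xfin.
by exists D, a, b.
Qed.

Lemma lebesgue_mu_sigma_subadditive : sigma_subadditive (@lebesgue_mu R m).
Proof.
move=> A; have [[i ioo]|] := pselect (exists i, lebesgue_mu (A i) = +oo%E).
  rewrite (eseries_pinfty _ _ ioo) ?leey// => n _.
  by rewrite -ltNye (lt_le_trans _ (lebesgue_mu_ge0 _)).
rewrite -forallNE => Aoo.
apply/lee_addgt0Pr => e e0.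
apply: le_trans (epsilon_trick _ _ (ltW e0)); last by move=> n; exact: lebesgue_mu_ge0.
have e_gt0 n : 0 < e / (2 ^ n.+1)%:R by rewrite divr_gt0// ltr0n expn_gt0.
have /choice[D] : forall n, exists (D : set nat) (a b : nat -> 'rV[R]_m), box_cover (A n) D a b /\
    (\esum_(k in D) (box_volume (a k) (b k))%:E <=
     lebesgue_mu (A n) + (e / (2 ^ n.+1)%:R)%:E)%E.
  by move=> n; apply: lebesgue_mu_cover => //; rewrite ltey; exact/eqP/Aoo.
move=> /choice[a] /choice[b] h.
apply: (@le_trans _ _ (\esum_(k in [set: nat] `*`` D)
    (box_volume (a k.1 k.2) (b k.1 k.2))%:E)%E).
  apply: (@lebesgue_mu_le_cover (nat * nat)%type _ (fun k => a k.1 k.2) (fun k => b k.1 k.2)).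
    by move=> [n k] [_ /= Dk]; have [[h1 _] _] := h n; exact: h1.
  move=> x [n _ /((h n).1.2)[k Dk xk]].
  by exists (n, k).
rewrite -(@esum_esum _ _ _ _ _ (fun n k => (box_volume (a n k) (b n k))%:E)); last first.
  by move=> n k _ Dk; rewrite lee_fin box_volume_ge0//; exact: ((h n).1.1).
rewrite nneseries_esumT; last by move=> n; rewrite adde_ge0 ?lebesgue_mu_ge0// lee_fin ltW.
by apply: le_esum => n _; exact: (h n).2.
Qed.

HB.instance Definition _ := isOuterMeasure.Build R 'rV[R]_m (@lebesgue_mu R m)
  lebesgue_mu0 lebesgue_mu_ge0 le_lebesgue_mu lebesgue_mu_sigma_subadditive.

Lemma lebesgue_muU X Y : (lebesgue_mu (X `|` Y) <= lebesgue_mu X + lebesgue_mu Y)%E.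
Proof. exact: outer_measureU2. Qed.

Lemma lebesgue_mu_box a b : le_corner a b ->
  (lebesgue_mu (box a b) <= (box_volume a b)%:E)%E.
Proof.
move=> ab.
have := @lebesgue_mu_le_cover nat [set 0%N] (fun=> a) (fun=> b) (box a b).
rewrite esum_set1 ?lee_fin ?box_volume_ge0//; apply => // x xab.
by exists 0%N.
Qed.

Definition shift_set v X : set 'rV[R]_m := [set x | X (x + v)].

Lemma lebesgue_mu_shift_le v X : (lebesgue_mu (shift_set v X) <= lebesgue_mu X)%E.
Proof.
apply: le_ereal_inf_tmp => _ [D [a [b [[ab XD] ->]]]].
rewrite (@eq_esum _ _ _ _ (fun k => (box_volume (a k - v) (b k - v))%:E)); last first.
  move=> k _; congr EFin; apply: eq_bigr => i _; rewrite !mxE; ring.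
apply: (@lebesgue_mu_le_cover nat D (fun k => a k - v) (fun k => b k - v)).
  by move=> k Dk i; rewrite !mxE lerD2r; exact: ab.
move=> x /XD[k Dk xk]; exists k => // i; have := xk i.
by rewrite !mxE lerBlDr lerBrDr.
Qed.

Lemma lebesgue_mu_shift v X : lebesgue_mu (shift_set v X) = lebesgue_mu X.
Proof.
apply/eqP; rewrite eq_le lebesgue_mu_shift_le /=.
apply: le_trans (lebesgue_mu_shift_le (- v) (shift_set v X)).
by apply: le_lebesgue_mu => x Xx; rewrite /shift_set /= subrK.
Qed.

Lemma lebesgue_measurable_shift v A :
  lebesgue_measurable A -> lebesgue_measurable (shift_set v A).
Proof.
move=> mA X; rewrite -(lebesgue_mu_shift (- v)) (mA (shift_set (- v) X)).
congr (_ + _)%E; rewrite -(lebesgue_mu_shift v); congr (lebesgue_mu _);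
by apply/seteqP; split => x; rewrite /shift_set/= ?addrK ?subrK.
Qed.

Definition set_coord a (i0 : 'I_m) (c : R) : 'rV[R]_m :=
  \row_i (if i == i0 then c else a ord0 i).

(** The hyperplane cuts every box of a cover into two boxes with the same total volume. The
    hypotheses fit both the open and the closed half-space. *)
Lemma halfspace_measurable (i0 : 'I_m) (c : R) (H : set 'rV[R]_m) :
  (forall x : 'rV[R]_m, x ord0 i0 < c -> H x) -> (forall x, H x -> x ord0 i0 <= c) ->
  lebesgue_measurable H.
Proof.
move=> H1 H2; apply: le_caratheodory_measurable => X.
apply: le_ereal_inf_tmp => _ [D [a [b [[ab XD] ->]]]].
(* [c] clamped to the side of the box, so a box lying on one side of the hyperplane yields a
   degenerate second piece. *)
pose c' k := Num.max (a k ord0 i0) (Num.min (b k ord0 i0) c).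
have c'P k : D k -> a k ord0 i0 <= c' k <= b k ord0 i0.
  move=> Dk; have h := ab k Dk i0.
  by rewrite /c' le_max lexx /= ge_max h /= ge_min lexx.
rewrite (@eq_esum _ _ _ _ (fun k => (box_volume (a k) (set_coord (b k) i0 (c' k)))%:E +
   (box_volume (set_coord (a k) i0 (c' k)) (b k))%:E)%E); last first.
  move=> k Dk; rewrite -EFinD; congr EFin; rewrite /box_volume.
  rewrite (bigD1 i0)//= [in X in _ = X + _](bigD1 i0)//= [in X in _ = _ + X](bigD1 i0)//=.
  rewrite !mxE eqxx.
  rewrite [in X in _ = X + _](eq_bigr (fun i => b k ord0 i - a k ord0 i)); last first.
    by move=> i /negPf ni; rewrite mxE ni.
  rewrite [in X in _ = _ + X](eq_bigr (fun i => b k ord0 i - a k ord0 i)); last first.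
    by move=> i /negPf ni; rewrite mxE ni.
  by ring.
have h1 k : D k -> le_corner (a k) (set_coord (b k) i0 (c' k)).
  move=> Dk i; rewrite mxE; case: eqP => [->|_]; last exact: ab.
  by case/andP: (c'P k Dk).
have h2 k : D k -> le_corner (set_coord (a k) i0 (c' k)) (b k).
  move=> Dk i; rewrite mxE; case: eqP => [->|_]; last exact: ab.
  by case/andP: (c'P k Dk).
rewrite esumD; [|by move=> k Dk; rewrite lee_fin box_volume_ge0//; auto..].
apply: leeD; apply: lebesgue_mu_le_cover => // x [/XD[k Dk xk] Hx]; exists k => // i;
  have := xk i; rewrite mxE; case: eqP => [->|//] /andP[xa xb].
  rewrite xa /= /c' le_max le_min xb (H2 _ Hx) orbT//.
rewrite xb andbT /c' ge_max xa /= ge_min.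
by rewrite (_ : c <= x ord0 i0) ?orbT// leNgt; apply/negP => /H1.
Qed.

Lemma lebesgue_measurableT : lebesgue_measurable [set: 'rV[R]_m].
Proof.
rewrite -setC0; apply: caratheodory_measurable_setC.
exact: caratheodory_measurable_set0.
Qed.

Lemma box_measurable a b : lebesgue_measurable (box a b).
Proof.
have h (s : seq 'I_m) : lebesgue_measurable
    [set x : 'rV[R]_m | forall i, i \in s -> a ord0 i <= x ord0 i <= b ord0 i].
  elim: s => [|i s IH].
    rewrite (_ : mkset _ = setT); first exact: lebesgue_measurableT.
    by apply/seteqP; split.
  rewrite (_ : mkset _ = (~` [set x : 'rV[R]_m | x ord0 i < a ord0 i] `&`
     [set x : 'rV[R]_m | x ord0 i <= b ord0 i]) `&`
     [set x : 'rV[R]_m | forall i, i \in s -> a ord0 i <= x ord0 i <= b ord0 i]).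
    apply: caratheodory_measurable_setI => //; apply: caratheodory_measurable_setI.
      apply: caratheodory_measurable_setC.
      by apply: (@halfspace_measurable i (a ord0 i)) => x //= /ltW.
    by apply: (@halfspace_measurable i (b ord0 i)) => x //= /ltW.
  apply/seteqP; split => x /=.
    move=> hx; split; first split.
    - by apply/negP; rewrite -leNgt; case/andP: (hx i (mem_head _ _)).
    - by case/andP: (hx i (mem_head _ _)).
    - by move=> j js; apply: hx; rewrite in_cons js orbT.
  move=> [[/negP]]; rewrite -leNgt => h1 h2 h3 j; rewrite in_cons => /orP[/eqP ->|/h3//].
  by rewrite h1.
have := h (enum 'I_m); rewrite (_ : mkset _ = box a b)//.
by apply/seteqP; split => x /= hx i => [|_]; apply: hx; rewrite mem_enum.
Qed.

End OuterMeasure.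

(** * Continuity of translations in measure *)

Lemma horner_right_of0 {R : realType} (p : {poly R}) (e : R) : 0 < e ->
  exists2 r, 0 < r & p.[r] <= p.[0] + e.
Proof.
move=> e0; have : root (p - p.[0]%:P) 0 by rewrite /root !hornerE subrr.
move=> /factor_theorem[q hq]; have [u hu] := poly_disk_bound q 1.
pose r := Num.min 1 (e / (`|u| + 1)).
have u0 : 0 < `|u| + 1 by rewrite ltr_wpDl.
have r0 : 0 < r by rewrite lt_min ltr01 divr_gt0.
have r1 : r <= 1 by rewrite ge_min lexx.
exists r => //; rewrite -lerBlDl.
have -> : p.[r] - p.[0] = q.[r] * r.
  by rewrite -[p.[0] in LHS](hornerC _ r) -hornerN -hornerD hq !hornerE subr0.
have h : q.[r] <= `|u| + 1.
  apply: (le_trans (ler_norm _)); apply: (le_trans (hu r _)).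
    by rewrite ger0_norm// ltW.
  by apply: (le_trans (ler_norm _)); rewrite lerDl.
apply: (@le_trans _ _ ((`|u| + 1) * r)); first by rewrite ler_wpM2r// ltW.
rewrite mulrC -ler_pdivlMr//; by rewrite ge_min lexx orbT.
Qed.

(** The total volume of finitely many boxes enlarged by [t] is a polynomial in [t]. *)
Lemma enlarged_volume {R : realType} {m : nat} (a b : nat -> 'rV[R]_m) (s : seq nat)
    (e : R) : 0 < e ->
  exists2 r, 0 < r &
    \sum_(k <- s) box_volume (a k - const_mx r) (b k + const_mx r) <=
    \sum_(k <- s) box_volume (a k) (b k) + e.
Proof.
move=> e0.
pose p : {poly R} := \sum_(k <- s) \prod_(i < m)
  ((b k ord0 i - a k ord0 i)%:P + 'X *+ 2).
have pE t : p.[t] = \sum_(k <- s) box_volume (a k - const_mx t) (b k + const_mx t).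
  rewrite horner_sum; apply: eq_bigr => k _; rewrite horner_prod.
  apply: eq_bigr => i _; rewrite hornerD hornerC hornerMn hornerX !mxE mulr2n.
  by ring.
have [r r0 hr] := horner_right_of0 p e0; exists r => //.
move: hr; rewrite !pE => /le_trans; apply; rewrite lerD2r.
apply: ler_sum => k _; rewrite (_ : const_mx 0 = 0) ?subr0 ?addr0//.
Qed.

Section ShiftContinuity.
Context {R : realType} {m : nat}.
Implicit Types (A : set 'rV[R]_m) (v : 'rV[R]_m).

(** Up to a tail [T] of measure at most [e / 4], finitely many boxes cover [A], and small shifts
    keep them inside slightly larger boxes [U]. A point leaving [A] thus starts in [T] or lands in
    [U] outside [A]; measurability of [A] bounds the measure of the part of [U] and [T] outside [A]
    by [3 * e / 4]. *)
Lemma lebesgue_mu_shift_continuous A (e : R) :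
  lebesgue_measurable A -> (lebesgue_mu A < +oo)%E -> 0 < e ->
  exists2 r, 0 < r & forall v, (forall i, `|v ord0 i| <= r) ->
    (lebesgue_mu (A `\` shift_set v A) <= e%:E)%E.
Proof.
move=> mA Aoo e0; pose e4 := e / 4.
have e40 : 0 < e4 by rewrite divr_gt0.
have e44 : e = 4 * e4 by rewrite /e4; field.
have [D [a [b [[ab AD] hS]]]] := lebesgue_mu_cover e40 Aoo.
have Afin : lebesgue_mu A \is a fin_num by rewrite ge0_fin_numE// lebesgue_mu_ge0.
set vol := fun k => (box_volume (a k) (b k))%:E.
have vol0 k : D k -> (0 <= vol k)%E by move=> Dk; rewrite lee_fin box_volume_ge0//; exact: ab.
have Sfin : (\esum_(k in D) vol k)%E \is a fin_num.
  rewrite ge0_fin_numE ?esum_ge0//; apply: (le_lt_trans hS).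
  by rewrite lte_add_pinfty// ltry.
have [_ [F [finF FD] <-] hF] := ub_ereal_sup_adherent e40 Sfin.
have DF : D `&` F = F by apply/seteqP; split => [x []|x Fx] //; split => //; exact: FD.
have FE : (\esum_(k in F) vol k)%E = (\sum_(k <- fset_set F) box_volume (a k) (b k))%:E.
  rewrite esum_fset//; last by move=> i /set_mem /FD; exact: vol0.
  by rewrite fsbig_finite//= sumEFin.
set sF := \sum_(k <- fset_set F) box_volume (a k) (b k) in FE.
have tail : (\esum_(k in D `&` ~` F) vol k <= e4%:E)%E.
  have := esumID F D vol vol0; rewrite DF FE.
  move: hF; rewrite -[ereal_sup _]/(\esum_(k in D) vol k)%E.
  have -> : (\sum_(x \in F) vol x)%E = sF%:E by rewrite fsbig_finite//= sumEFin.
  have : (0 <= \esum_(k in D `&` ~` F) vol k)%E by apply: esum_ge0 => k [/vol0].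
  move: Sfin; case: (esum D vol) => // S _.
  case: (esum (D `&` ~` F) vol) => // t.
  by rewrite !lee_fin -EFinB lte_fin -EFinD => _ h [eS]; lra.
have [r r0 hr] := enlarged_volume a b ((fset_set F)) e40.
pose U := \bigcup_(k in F) box (a k - const_mx r) (b k + const_mx r).
pose T := \bigcup_(k in D `&` ~` F) box (a k) (b k).
have muT : (lebesgue_mu T <= e4%:E)%E.
  apply: le_trans tail; apply: (@lebesgue_mu_le_cover R m nat) => // k [Dk _].
  exact: ab.
have abr k : F k -> le_corner (a k - const_mx r) (b k + const_mx r).
  by move=> /FD Dk i; rewrite !mxE; have := ab k Dk i; lra.
have muU : (lebesgue_mu U <= (sF + e4)%:E)%E.
  apply: (@le_trans _ _ (\esum_(k in F)
    (box_volume (a k - const_mx r) (b k + const_mx r))%:E)%E).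
    exact: (@lebesgue_mu_le_cover R m nat).
  rewrite esum_fset//; last by move=> i /set_mem /abr h; rewrite lee_fin box_volume_ge0.
  by rewrite fsbig_finite//= sumEFin lee_fin.
have boxU k x : F k -> box (a k) (b k) x -> U x.
  move=> Fk xk; exists k => // i; have /andP[h1 h2] := xk i; rewrite !mxE.
  by apply/andP; split; lra.
have AUT : A `<=` U `|` T.
  move=> x /AD[k Dk xk]; have [Fk|nFk] := pselect (F k).
    by left; exact: boxU xk.
  by right; exists k.
have sFA : (sF%:E <= lebesgue_mu A + e4%:E)%E.
  by apply: le_trans hS; rewrite -FE (esumID F D)// DF leeDl//; apply: esum_ge0 => k [/vol0].
exists r => // v hv.
have sub : A `\` shift_set v A `<=` shift_set v ((U `|` T) `\` A) `|` T.
  move=> x [Ax nAx]; have [k Dk xk] := AD x Ax; have [Fk|nFk] := pselect (F k).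
    left; split => //; left; exists k => // i; have := xk i; have := hv i.
    by rewrite !mxE ler_norml => /andP[? ?] /andP[? ?]; apply/andP; split; lra.
  by right; exists k.
apply: (le_trans (le_lebesgue_mu sub)); apply: (le_trans (lebesgue_muU _ _)).
rewrite lebesgue_mu_shift.
have := mA (U `|` T); rewrite (_ : (U `|` T) `&` A = A); last first.
  by apply/seteqP; split => [x []|x Ax] //; split => //; exact: AUT.
rewrite -[(U `|` T) `&` ~` A]/((U `|` T) `\` A).
have := lebesgue_muU U T.
have := lebesgue_mu_ge0 ((U `|` T) `\` A).
move: muT muU sFA (lebesgue_mu_ge0 T) (lebesgue_mu_ge0 U) Afin.
case: (lebesgue_mu A) => // M; case: (lebesgue_mu T) => // t.
case: (lebesgue_mu U) => // u; case: (lebesgue_mu ((U `|` T) `\` A)) => [w||] //;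
  case: (lebesgue_mu (U `|` T)) => // w'.
rewrite -!EFinD !lee_fin => ? ? ? ? ? _ ? ? [] ?; lra.
Qed.

End ShiftContinuity.

(** * Nonnegative functions with a finite integral *)

Section Integ.
Context {R : realType} {m : nat}.
Implicit Types (A : set 'rV[R]_m) (h : 'rV[R]_m -> R).

Definition lebesgue_outer : {outer_measure set 'rV[R]_m -> \bar R} := @lebesgue_mu R m.

(** The integral is recorded as a real number, so that averages over the finite group are handled as
    finite linear combinations in [R]. *)
Definition integ h (B : R) : Prop :=
  [/\ measurable_fun [set: caratheodory_type lebesgue_outer]
        (h : caratheodory_type lebesgue_outer -> R),
      forall x, 0 <= h x &
      (\int[lebesgue_outer : {measure set (caratheodory_type lebesgue_outer) -> \bar R}]_x
         (h x)%:E)%E = B%:E].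

Lemma integ_indic A : lebesgue_measurable A -> (lebesgue_mu A < +oo)%E ->
  integ (\1_A) (fine (lebesgue_mu A)).
Proof.
move=> mA Aoo.
have mA' : measurable (A : set (caratheodory_type lebesgue_outer)) by [].
split; first exact: measurable_indic.
  by move=> x; rewrite indicE ler0n.
rewrite integral_indic// setIT fineK// ge0_fin_numE//; exact: lebesgue_mu_ge0.
Qed.

Lemma integ_sum (I : Type) (s : seq I) (w : I -> R) (h : I -> 'rV[R]_m -> R) (B : I -> R) :
  (forall i, 0 <= w i) -> (forall i, integ (h i) (B i)) ->
  integ (fun x => \sum_(i <- s) w i * h i x) (\sum_(i <- s) w i * B i).
Proof.
move=> w0 hB; split.
- by apply: measurable_sum => i; apply: measurable_funM => //; case: (hB i).
- by move=> x; apply: sumr_ge0 => i _; rewrite mulr_ge0//; case: (hB i).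
under eq_integral do rewrite -sumEFin.
rewrite ge0_integral_sum//; last 2 first.
- move=> i; apply/measurable_EFinP; apply: measurable_funM => //; by case: (hB i).
- by move=> i x _; rewrite lee_fin mulr_ge0//; case: (hB i).
rewrite -sumEFin; apply: eq_bigr => i _; have [h1 h2 h3] := hB i.
under eq_integral do rewrite EFinM.
rewrite ge0_integralZl_EFin//; last 2 first.
- by move=> x _; rewrite lee_fin.
- exact/measurable_EFinP.
by rewrite h3 EFinM.
Qed.

Lemma integ_le h h' B B' : integ h B -> integ h' B' -> (forall x, h x <= h' x) -> B <= B'.
Proof.
move=> [h1 h2 h3] [h4 h5 h6] hh; rewrite -lee_fin -h3 -h6.
apply: ge0_le_integral => //.
- by move=> x _; rewrite lee_fin.
- exact/measurable_EFinP.
- exact/measurable_EFinP.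
- by move=> x _; rewrite lee_fin.
Qed.

Lemma eq_integ h h' B B' : h =1 h' -> B = B' -> integ h B -> integ h' B'.
Proof. by move=> /funext -> ->. Qed.

End Integ.

(** * Sampling on a fine grid *)

Section Wlist.
Context {R : realType} {G : finZmodType}.
Implicit Types (f p : G -> R) (ps : seq (G -> R)) (ts : seq G) (Q : seq G -> R).

(** Unlike [wcount], this average keeps the list of edges, since the rounding error to be averaged
    depends on the edges themselves. *)
Fixpoint wlist ps Q : R :=
  if ps is p :: ps' then expect p (fun s => wlist ps' (fun ts => Q (s :: ts))) else Q [::].

Lemma wcount_wlist ps f :
  wcount mean ps f = wlist ps (fun ts => mean (foldl shiftM f ts)).
Proof. by elim: ps f => //= p ps IH f; apply: eq_expect => s; rewrite IH. Qed.

Fixpoint charged ps ts : Prop :=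
  match ps, ts with
  | [::], [::] => True
  | p :: ps', t :: ts' => p t != 0 /\ charged ps' ts'
  | _, _ => False
  end.

Lemma charged_nth p0 ps ts : charged ps ts ->
  size ts = size ps /\ forall k, (k < size ps)%N -> nth p0 ps k (nth 0 ts k) != 0.
Proof.
elim: ps ts => [|p ps IH] [|t ts]//= [pt /IH[-> h]]; split=> // -[|k]//.
exact: h.
Qed.

Lemma le_wlist ps Q Q' : all_prob ps -> (forall ts, charged ps ts -> Q ts <= Q' ts) ->
  wlist ps Q <= wlist ps Q'.
Proof.
elim: ps Q Q' => [|p ps IH] Q Q' /=; first by move=> _; exact.
move=> [pp hps] h; apply: le_expect pp.1 _ => s ps0; apply: IH => // ts cts.
exact: h.
Qed.

Lemma foldl_shiftM_neq0 f ts x : foldl shiftM f ts x != 0 ->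
  forall k : nat -> bool,
    f (x + \sum_(i < size ts) (if k i then nth 0 ts i else 0)) != 0.
Proof.
elim: ts f => [|t ts IH] f /= h k; first by rewrite big_ord0 addr0.
have := IH _ h (fun i => k i.+1); rewrite /shiftM mulf_eq0 negb_or => /andP[h1 h2].
rewrite big_ord_recl /=; case: (k 0%N); last by rewrite add0r.
by rewrite addrCA addrC.
Qed.

Lemma unitval_foldl_shiftM f ts : unitval f -> unitval (foldl shiftM f ts).
Proof.
by elim: ts f => //= t ts IH f hf; apply: IH; exact: unitval_shift.
Qed.

Lemma integ_wlist (m : nat) ps (Q : seq G -> 'rV[R]_m -> R) (bnd : R) :
  all_prob ps -> (forall ts, exists2 B, B <= bnd & integ (Q ts) B) ->
  exists2 B, B <= bnd & integ (fun x => wlist ps (fun ts => Q ts x)) B.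
Proof.
elim: ps Q => [|p ps IH] Q /=; first by move=> _ /(_ [::]).
move=> [pp hps] h.
have {}h s : exists B, B <= bnd /\ integ (fun x => wlist ps (fun ts => Q (s :: ts) x)) B.
  have [B hB iB] := IH (fun ts => Q (s :: ts)) hps (fun ts => h (s :: ts)).
  by exists B.
have [B hB] := choice h.
exists (\sum_s p s * B s); last first.
  exact: (integ_sum _ pp.1 (fun s => (hB s).2)).
by rewrite -(expect_cst bnd pp); apply: le_expect pp.1 _ => s _; case: (hB s).
Qed.

End Wlist.

Section Sampling.
Context {R : realType} {m : nat} (Q : nat) (tau : R).
Let G : finZmodType := 'rV['I_(2 * Q).+2]_m.
Implicit Types (g : G) (x : 'rV[R]_m) (A : set 'rV[R]_m).

Definition grid_pt g : 'rV[R]_m := \row_c (tau * (g ord0 c : nat)%:R).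

(* Only the part [0, Q]^m of the cyclic group is used, so that the sums of two
   of its points do not wrap around. *)
Definition in_cube g : bool := [forall c, (g ord0 c <= Q)%N].

Definition sample A x g : R := (in_cube g)%:R * \1_A (x + grid_pt g).

Lemma sample_itv A x g : 0 <= sample A x g <= 1.
Proof.
rewrite /sample indicE; case: (in_cube g); case: (_ \in _);
by rewrite ?mul0r ?mulr0 ?mulr1 ?lexx ?ler01.
Qed.

Lemma integ_mean_sample A : lebesgue_measurable A -> (lebesgue_mu A < +oo)%E ->
  integ (fun x => mean (sample A x))
    (mean (fun g => (in_cube g)%:R) * fine (lebesgue_mu A)).
Proof.
move=> mA Aoo.
pose w g : R := (in_cube g)%:R / #|G|%:R.
have w0 g : 0 <= w g by rewrite /w divr_ge0 ?ler0n.
have h g : integ (\1_(shift_set (grid_pt g) A)) (fine (lebesgue_mu A)).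
  rewrite -(lebesgue_mu_shift (grid_pt g) A); apply: integ_indic.
    exact: lebesgue_measurable_shift.
  by rewrite lebesgue_mu_shift.
apply: eq_integ (integ_sum (index_enum G) w0 h).
  move=> x; rewrite /mean mulr_suml; apply: eq_bigr => g _.
  by rewrite /w /sample mulrAC !indicE; congr (_ * _ / _).
by rewrite /mean mulr_suml mulr_suml.
Qed.

Lemma mean_in_cube_le1 : mean (fun g => (in_cube g)%:R : R) <= 1.
Proof.
by rewrite -[leRHS](@mean_cst R G 1); apply: le_mean => g /=; rewrite lern1 leq_b1.
Qed.

(** In each coordinate the cube uses [Q.+1] of the [(2 * Q).+2] residues, exactly one half. *)
Lemma mean_in_cube_ge : 2 ^- m <= mean (fun g => (in_cube g)%:R : R).
Proof.
pose inc (h : 'rV['I_Q.+1]_m) : G := \row_c (inord (h ord0 c) : 'I_(2 * Q).+2).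
have lt (h : 'rV['I_Q.+1]_m) c : (h ord0 c < (2 * Q).+2)%N by have := ltn_ord (h ord0 c); lia.
have inc_inj : injective inc.
  move=> h h' /rowP e; apply/rowP => c; apply/val_inj.
  by have := congr1 val (e c); rewrite !mxE /= !inordK.
have cG : #|G| = ((2 * Q).+2 ^ m)%N by rewrite card_mx card_ord mul1n.
have cH : (Q.+1 ^ m <= #|[pred g : G | in_cube g]|)%N.
  have -> : (Q.+1 ^ m)%N = #|codom inc|.
    by rewrite card_codom// card_mx card_ord mul1n.
  apply: subset_leq_card; apply/fintype.subsetP => _ /codomP[h ->]; rewrite inE.
  by apply/forallP => c; rewrite mxE inordK// -ltnS.
rewrite /mean ler_pdivlMr ?cardG_gt0// -natr_sum.
have -> : (\sum_(g : G) in_cube g = #|[pred g : G | in_cube g]|)%N.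
  by rewrite -sum1_card [RHS]big_mkcond; apply: eq_bigr => g _; rewrite inE; case: in_cube.
apply: (@le_trans _ _ ((Q.+1 ^ m)%N%:R)); last by rewrite ler_nat.
rewrite cG (_ : (2 * Q).+2 = 2 * Q.+1)%N; last by lia.
by rewrite expnMn natrM !natrX mulrA mulVf ?mul1r// expf_neq0.
Qed.

End Sampling.

Lemma upper_banach_density_cube {R : realType} {m : nat} (A : set 'rV[R]_m) :
  (0 < upper_banach_density A)%E ->
  exists2 delta : R, 0 < delta & forall N0 : R, exists N x0,
    N0 < N /\ ((delta * N ^+ m)%:E <= lebesgue_mu (A `&` box x0 (x0 + const_mx N)))%E.
Proof.
move=> dA; have [delta d0 hd] : exists2 delta : R, 0 < delta &
    (delta%:E < upper_banach_density A)%E.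
  move: dA; case: (upper_banach_density A) => [r|_|] //.
    by rewrite lte_fin => r0; exists (r / 2); rewrite ?divr_gt0// lte_fin; lra.
  by exists 1; rewrite // ltry.
exists delta => // N0.
move: hd; rewrite /upper_banach_density limf_esupE => hd.
set g := (fun N : R => _) in hd.
(* The bound 1 keeps [N ^+ m] positive, so that the normalization can be cleared. *)
pose V := [set N : R | Num.max 1 N0 < N].
have hV : (ereal_inf [set ereal_sup [set g N | N in W] | W in (+oo%R : set_system R)]
    <= ereal_sup [set g N | N in V])%E.
  by apply: ereal_inf_lbound; exists V => //; apply: nbhs_pinfty_gt; exact: num_real.
have [_ [N VN <-] gN] := ereal_sup_gt (lt_le_trans hd hV).
have [_ [x0 _ <-] hx0] := ereal_sup_gt gN.
move: VN; rewrite /V /= gt_max => /andP[N1 N0N].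
exists N, x0; split => //.
have e : [set x0 + y | y in box 0 (const_mx N)] = box x0 (x0 + const_mx N).
  apply/seteqP; split => [_ [y hy <-] i|x hx].
    by have := hy i; rewrite !mxE => /andP[? ?]; apply/andP; split; lra.
  exists (x - x0); last by rewrite addrC subrK.
  by move=> i; have := hx i; rewrite !mxE => /andP[? ?]; apply/andP; split; lra.
move: hx0; rewrite e.
have N0' : 0 < N ^+ m by rewrite exprn_gt0// (lt_trans _ N1).
case: (lebesgue_mu _) (lebesgue_mu_ge0 (A `&` box x0 (x0 + const_mx N))) => [r|_ _|] //.
  by rewrite -EFinM lte_fin lee_fin => _ /ltW; rewrite ler_pdivlMr.
by rewrite leey.
Qed.

(** * Exact boxes near grid parallelepipeds *)

Section Boxes.
Context {R : realType} {n : nat} {d : 'I_n -> nat} (Q : nat) (tau : R).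
Let D := (\sum_(j < n) d j)%N.
Let G : finZmodType := 'rV['I_(2 * Q).+2]_D.
Implicit Types (g : G) (k : 'I_n -> bool) (U Y : 'I_n -> nat) (a : 'I_n -> R).

(** The basis vector of coordinate [r] of factor [i]; [tagnat] splits a coordinate of the product
    into its factor and its place there. As [r] is a plain number, 0 and 1 need no bound from
    [d i]. *)
Definition axis (r : nat) (i : 'I_n) : G :=
  \row_c ((tagnat.sig1 c == i) && (tagnat.sig2 c == r :> nat))%:R.

Definition steps U Y k (c : 'I_D) : nat :=
  if k (tagnat.sig1 c) then
    if tagnat.sig2 c == 0 :> nat then U (tagnat.sig1 c)
    else if tagnat.sig2 c == 1 :> nat then Y (tagnat.sig1 c) else 0
  else 0.

Lemma sum_axis U Y k :
  \sum_i (if k i then axis 0 i *+ U i + axis 1 i *+ Y i else 0) =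
  \row_c (steps U Y k c)%:R :> G.
Proof.
apply/rowP => c; rewrite summxE mxE (bigD1 (tagnat.sig1 c))//= big1 ?addr0; last first.
  move=> i /negPf ni; case: (k i); rewrite ?mxE// !mulmxnE !mxE eq_sym ni /=.
  by rewrite !mul0rn addr0.
rewrite /steps; case: (k _); rewrite ?mxE// !mulmxnE !mxE eqxx /=.
case: eqP => [->|_] /=; first by rewrite mul0rn addr0.
by rewrite mul0rn add0r; case: eqP => //= _; rewrite mul0rn.
Qed.

Lemma steps_le U Y k c : (forall i, (U i <= Q)%N) -> (forall i, (Y i <= Q)%N) ->
  (steps U Y k c <= Q)%N.
Proof. by move=> hU hY; rewrite /steps; do !case: ifP. Qed.

Lemma grid_ptD g U Y k : in_cube g -> (forall i, (U i <= Q)%N) ->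
  (forall i, (Y i <= Q)%N) ->
  grid_pt tau (g + \sum_i (if k i then axis 0 i *+ U i + axis 1 i *+ Y i else 0)) =
  grid_pt tau g + \row_c (tau * (steps U Y k c)%:R).
Proof.
move=> /forallP hg hU hY; rewrite sum_axis; apply/rowP => c; rewrite !mxE -mulrDr -natrD.
congr (_ * _%:R); rewrite Zp_nat /= modnDmr modn_small//.
apply: (leq_ltn_trans (leq_add (hg c) (steps_le k c hU hY))).
by rewrite addnn -mul2n; exact: leqnSn.
Qed.

Definition side Y a (j : 'I_n) : 'rV[R]_(d j) :=
  \row_c (if c == 0 :> nat then tau * a j else if c == 1 :> nat then tau * (Y j)%:R else 0).

(** The rounding error at vertex [k]. It depends on the edges but not on the base point, so for
    given edges each vertex involves one fixed translate of the set. *)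
Definition offset U k a : 'rV[R]_D :=
  \row_c (if k (tagnat.sig1 c) && (tagnat.sig2 c == 0 :> nat)
          then tau * (a (tagnat.sig1 c) - (U (tagnat.sig1 c))%:R) else 0).

Lemma box_vertex g U Y k a (x : 'rV[R]_D) : in_cube g -> (forall i, (U i <= Q)%N) ->
  (forall i, (Y i <= Q)%N) ->
  \mxrow_(j < n) (submxrow (x + grid_pt tau g) j + (k j)%:R *: side Y a j) =
  x + grid_pt tau (g + \sum_i (if k i then axis 0 i *+ U i + axis 1 i *+ Y i else 0))
    + offset U k a.
Proof.
move=> hg hU hY; rewrite (grid_ptD _ hg hU hY); apply/rowP => c.
rewrite mxE !mxE tagnat.sig2K /steps.
case: (k _); rewrite /= ?mul0r ?mulr0 ?addr0// mul1r.
by case: eqP => [_|_] /=; [ring|case: eqP => _; ring].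
Qed.

Lemma l2norm_side Y a (j : 'I_n) (rho : R) : (2 <= d j)%N -> 0 <= tau -> 0 <= rho ->
  a j ^+ 2 + (Y j)%:R ^+ 2 = rho ^+ 2 -> l2norm (side Y a j) = tau * rho.
Proof.
move=> dj tau0 rho0 e; rewrite /l2norm.
have d1 : (1 < d j)%N by []. have d0 : (0 < d j)%N by exact: ltnW.
rewrite (bigD1 (Ordinal d0))//= (bigD1 (Ordinal d1))//= big1 ?addr0.
  rewrite !mxE /= !exprMn -mulrDr e -exprMn sqrtr_sqr ger0_norm//.
  exact: mulr_ge0.
move=> i /andP[i0 i1]; rewrite mxE.
by rewrite -val_eqE /= in i0; rewrite -val_eqE /= in i1;
  rewrite (negPf i0) (negPf i1) expr0n.
Qed.

Lemma offset_le U k a (e : R) : 0 <= tau -> 0 <= e -> (forall i, `|a i - (U i)%:R| <= e) ->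
  forall c, `|offset U k a ord0 c| <= tau * e.
Proof.
move=> tau0 e0 h c; rewrite mxE; case: ifP => _; last by rewrite normr0 mulr_ge0.
by rewrite normrM ger0_norm// ler_wpM2l.
Qed.

End Boxes.

Definition has_box {R : realType} {n : nat} (a : 'I_n -> R) (d : 'I_n -> nat)
    (A : set 'rV[R]_(\sum_(j < n) d j)) (lambda : R) : Prop :=
  exists x s : forall j : 'I_n, 'rV[R]_(d j),
    (forall j, l2norm (s j) = lambda * a j) /\
    (forall k : 'I_n -> bool, A (\mxrow_(j < n) (x j + (k j)%:R *: s j))).

Section Defect.
Context {R : realType} {n : nat} {d : 'I_n -> nat} (Q : nat) (tau : R).
Let D := (\sum_(j < n) d j)%N.
Let G : finZmodType := 'rV['I_(2 * Q).+2]_D.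

Definition leaving (A : set 'rV[R]_D) (v : 'rV[R]_D) : set 'rV[R]_D :=
  A `\` shift_set v A.

(* Intended for U i t the rounding to the grid of the exact coordinate arcv i t
   of a shift t in the i-th direction. *)
Definition defect (A : set 'rV[R]_D) (U : 'I_n -> G -> nat) (arcv : 'I_n -> G -> R)
    (ts : seq G) (x : 'rV[R]_D) : R :=
  \sum_(k : {ffun 'I_n -> bool})
    mean (sample tau (leaving A (offset tau (fun i => U i (nth 0 ts i)) k
                                  (fun i => arcv i (nth 0 ts i)))) x : G -> R).

(** The bound must not depend on [ts], since the defect is averaged over random edges; indeed every
    offset is a shift of size at most [r], and there are [2 ^ n] vertices. *)
Lemma integ_defect (A : set 'rV[R]_D) (U : 'I_n -> G -> nat)
    (arcv : 'I_n -> G -> R) (ts : seq G) (r e : R) : lebesgue_measurable A ->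
  0 <= tau -> 0 <= e -> tau * e <= r ->
  (forall i t, `|arcv i t - (U i t)%:R| <= e) -> forall eta : R, 0 <= eta ->
  (forall v : 'rV[R]_D, (forall i, `|v ord0 i| <= r) -> (lebesgue_mu (leaving A v) <= eta%:E)%E) ->
  exists2 B, B <= 2 ^+ n * eta & integ (defect A U arcv ts) B.
Proof.
move=> mA tau0 e0 er hU eta eta0 heta.
pose v (k : {ffun 'I_n -> bool}) : 'rV[R]_D := offset tau (fun i => U i (nth 0 ts i)) k
  (fun i => arcv i (nth 0 ts i)).
have hv k : (lebesgue_mu (leaving A (v k)) <= eta%:E)%E.
  by apply: heta => c; apply: le_trans er; exact: offset_le.
have vfin k : (lebesgue_mu (leaving A (v k)) < +oo)%E by apply: le_lt_trans (hv k) (ltry _).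
have mv k : lebesgue_measurable (leaving A (v k)).
  apply: caratheodory_measurable_setD => //; exact: lebesgue_measurable_shift.
have h k := integ_mean_sample Q tau (mv k) (vfin k).
exists (\sum_(k : {ffun 'I_n -> bool}) 1 *
   (mean (fun g : G => (in_cube g)%:R) * fine (lebesgue_mu (leaving A (v k))))); last first.
  apply: eq_integ (integ_sum (index_enum {ffun 'I_n -> bool}) (fun=> ler01) h) => // x.
  by apply: eq_bigr => k _; rewrite mul1r.
apply: (@le_trans _ _ (\sum_(k : {ffun 'I_n -> bool}) eta)).
  apply: ler_sum => k _; rewrite mul1r.
  have f0 : 0 <= fine (lebesgue_mu (leaving A (v k))) by rewrite fine_ge0// lebesgue_mu_ge0.
  apply: (@le_trans _ _ (fine (lebesgue_mu (leaving A (v k))))).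
    by rewrite ler_piMl// mean_in_cube_le1.
  by rewrite -lee_fin fineK// ge0_fin_numE// lebesgue_mu_ge0.
by rewrite sumr_const card_ffun card_bool card_ord -[_ *+ _]mulr_natl natrX.
Qed.

(** If the product at [g] does not vanish, all rounded vertices lie in [A]. Without a box in [A']
    some exact vertex lies outside [A], so its rounded vertex is in a [leaving] set and that summand
    of the defect equals 1. Two sets occur because only a bounded part of the given set is
    sampled. *)
Lemma box_count_le_defect (a : 'I_n -> R) (d_ge2 : forall j, (2 <= d j)%N) (A A' : set 'rV[R]_D)
    (U Y : 'I_n -> G -> nat) (arcv : 'I_n -> G -> R) (T : 'I_n -> G -> R) (lambda : R)
    (rho : 'I_n -> R) (x : 'rV[R]_D) :
  A `<=` A' -> 0 <= tau -> ~ has_box a A' lambda ->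
  (forall i, prob (T i)) -> (forall i, 0 <= rho i) ->
  (forall i, tau * rho i = lambda * a i) ->
  (forall i t, T i t != 0 -> [/\ t = axis Q 0 i *+ U i t + axis Q 1 i *+ Y i t,
     (U i t <= Q)%N, (Y i t <= Q)%N & arcv i t ^+ 2 + (Y i t)%:R ^+ 2 = rho i ^+ 2]) ->
  wcount mean [seq T i | i <- enum 'I_n] (sample tau A x) <=
  wlist [seq T i | i <- enum 'I_n] (fun ts => defect A U arcv ts x).
Proof.
move=> AA' tau0 nobox pT rho0 hrho hT.
rewrite wcount_wlist; apply: le_wlist; first exact: all_prob_map.
move=> ts /(charged_nth (fun=> 0)); rewrite size_map size_enum_ord => -[sts hts].
have {}hts i : T i (nth 0 ts i) != 0.
  have := hts i (ltn_ord i); rewrite (nth_map i) ?size_enum_ord//.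
  by rewrite nth_ord_enum.
pose Ut i := U i (nth 0 ts i); pose Yt i := Y i (nth 0 ts i).
pose at' i := arcv i (nth 0 ts i).
have hU i : (Ut i <= Q)%N by case: (hT _ _ (hts i)).
have hY i : (Yt i <= Q)%N by case: (hT _ _ (hts i)).
pose tk (k : {ffun 'I_n -> bool}) : G :=
  \sum_i (if k i then axis Q 0 i *+ Ut i + axis Q 1 i *+ Yt i else 0).
pose v (k : 'I_n -> bool) : 'rV[R]_D := offset tau Ut k at'.
have -> : defect A U arcv ts x =
    mean (fun g : G => \sum_(k : {ffun 'I_n -> bool}) sample tau (leaving A (v k)) x (g + tk k)).
  by rewrite mean_sum; apply: eq_bigr => k _; rewrite mean_shift.
apply: le_mean => g.
have s0 (k : {ffun 'I_n -> bool}) : 0 <= sample tau (leaving A (v k)) x (g + tk k).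
  by case/andP: (sample_itv tau (leaving A (v k)) x (g + tk k)).
have [->|fg] := eqVneq (foldl shiftM (sample tau A x) ts g) 0; first exact: sumr_ge0.
have unit_s : unitval (sample tau A x : G -> R) by move=> h; exact: sample_itv.
have /andP[_ fg1] := unitval_foldl_shiftM ts unit_s g.
apply: (le_trans fg1).
have vert (k : {ffun 'I_n -> bool}) : sample tau A x (g + tk k) != 0.
  have := foldl_shiftM_neq0 fg (fun i => if insub i is Some j then k j else false).
  rewrite -(big_mkord xpredT (fun i => if (if insub i is Some j then k j else false)
    then nth 0 ts i else 0)) sts big_mkord.
  congr (sample _ _ _ (_ + _) != 0); apply: eq_bigr => i _; rewrite valK.
  by case: (k i) => //; have [] := hT _ _ (hts i).
have vertP (k : {ffun 'I_n -> bool}) :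
    in_cube (g + tk k) /\ A (x + grid_pt tau (g + tk k)).
  move: (vert k); rewrite /sample indicE mulf_eq0 negb_or !pnatr_eq0 !eqb0 !negbK.
  by move=> /andP[-> /set_mem].
(* Otherwise the exact vertices all lie in [A], and [side] provides sides of the exact length. *)
have [k hk] : exists k : {ffun 'I_n -> bool}, ~ A (x + grid_pt tau (g + tk k) + v k).
  apply: contrapT => /forallNP h; apply: nobox.
  exists (fun j => submxrow (x + grid_pt tau g) j), (side tau Yt at').
  split=> [j|k].
    rewrite -hrho; apply: l2norm_side => //.
    by have [] := hT _ _ (hts j).
  have g0 : in_cube g.
    have := (vertP [ffun=> false]).1; rewrite /tk big1 ?addr0// => i _.
    by rewrite ffunE.
  apply: AA'; rewrite (box_vertex tau k at' x g0 hU hY).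
  have := h [ffun i => k i]; move=> /contrapT; rewrite /tk /v.
  congr (A (_ + grid_pt _ (_ + _) + _)).
    by apply: eq_bigr => i _; rewrite ffunE.
  by apply/rowP => c; rewrite !mxE ffunE.
rewrite (bigD1 k)//= [leLHS](_ : 1 = sample tau (leaving A (v k)) x (g + tk k)).
  by rewrite lerDl sumr_ge0.
have [h1 h2] := vertP k.
by rewrite /sample h1 mul1r indicE mem_set.
Qed.

End Defect.

(** * Deduction of the theorem *)

Lemma lacunary_counterexamples {R : realType} (P : R -> Prop) (Lam : R) : 1 <= Lam ->
  ~ (exists2 l0 : R, 0 < l0 & forall l, l0 <= l -> P l) ->
  exists lam : nat -> R, [/\ 1 <= lam 0%N, forall j, Lam * lam j <= lam j.+1,
    forall j, 0 < lam j & forall j, ~ P (lam j)].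
Proof.
move=> Lam1 h.
have /choice[F hF] : forall l : R, exists l', 0 < l -> l <= l' /\ ~ P l'.
  move=> l; have [l0|_] := ltrP 0 l; last by exists 0.
  apply: contrapT => /forallNP hl; apply: h; exists l => // l' ll'.
  by apply: contrapT => nP; apply: (hl l').
pose lam := fix lam j := if j is j'.+1 then F (Lam * lam j') else F 1.
have lam0 j : 0 < lam j.
  elim: j => [|j IH] /=; first by apply: lt_le_trans (hF 1 ltr01).1.
  have L0 : 0 < Lam * lam j by rewrite mulr_gt0//; lra.
  exact: lt_le_trans L0 (hF _ L0).1.
have LL j : 0 < Lam * lam j by rewrite mulr_gt0//; lra.
exists lam; split=> //.
- exact: (hF 1 ltr01).1.
- by move=> j; exact: (hF _ (LL j)).1.
- by case=> [|j] /=; [exact: (hF 1 ltr01).2|exact: (hF _ (LL j)).2].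
Qed.

(** The rounding bound is asserted for every [t], as [integ_defect] requires; off the arc the pair
    of the point with second coordinate 0 serves as a default. *)
Lemma circle_decode {R : realType} {n : nat} {d : 'I_n -> nat} (Q : nat) (i : 'I_n)
    (rho b : R) (k : nat) (t : 'rV['I_(2 * Q).+2]_(\sum_(j < n) d j)) :
  0 <= rho -> b <= 1 -> rho + k%:R <= Q%:R ->
  exists UY : nat * nat, `|arc_height rho UY.2 - UY.1%:R| <= k%:R + 1 /\
    (circle (axis Q 0 i) (axis Q 1 i) rho (Num.trunc (b * rho)) k t != 0 :> R ->
     [/\ t = axis Q 0 i *+ UY.1 + axis Q 1 i *+ UY.2, (UY.1 <= Q)%N, (UY.2 <= Q)%N
       & arc_height rho UY.2 ^+ 2 + UY.2%:R ^+ 2 = rho ^+ 2]).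
Proof.
move=> rho0 b1 hQ.
have near y (u : nat) : (u <= k)%N ->
    `|arc_height rho y - (Num.trunc (arc_height rho y) + u)%N%:R| <= k%:R + 1.
  move=> uk; have := truncn_itv (arc_ge0 rho y); rewrite natrD -natr1 => /andP[h1 h2].
  have h3 : u%:R <= k%:R :> R by rewrite ler_nat.
  have h4 : 0 <= u%:R :> R by rewrite ler0n.
  by rewrite ler_norml; apply/andP; split; lra.
have [/unif_neq0[[y u] /= ->]|z] := pselect
  (circle (axis Q 0 i) (axis Q 1 i) rho (Num.trunc (b * rho)) k t != 0 :> R); last first.
  exists (Num.trunc (arc_height rho 0) + 0, 0)%N; split; first exact: near.
  by move=> /z.
exists (Num.trunc (arc_height rho y) + u, y : nat)%N; split=> /=.
  by apply: near; rewrite ltnW.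
move=> _.
have K0 : (y < Num.trunc (b * rho))%N by [].
have brho : y%:R <= rho.
  have [h|h] := lerP 0 (b * rho).
    have h1 : (Num.trunc (b * rho))%:R <= b * rho by rewrite truncn_le.
    have : y%:R <= (Num.trunc (b * rho))%:R :> R by rewrite ler_nat ltnW.
    have : b * rho <= rho by rewrite ler_piMl.
    lra.
  have := leq_ltn_trans (leq0n y) K0.
  by rewrite truncn_gt0 leNgt (lt_trans h ltr01).
have ta : (Num.trunc (arc_height rho y))%:R <= rho.
  by apply: le_trans (arc_le y rho0); rewrite truncn_le arc_ge0.
have uk : u%:R <= k%:R :> R by rewrite ler_nat ltnW.
have k0 : 0 <= k%:R :> R by rewrite ler0n.
split => //.
- by rewrite -(ler_nat R) natrD; lra.
- by rewrite -(ler_nat R); lra.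
by rewrite sqr_arc// subrK.
Qed.

(** The contradiction comes from integrating over the translate [x] of the grid. The sampled density
    of [B] has integral at least [2 ^- D * vN]; pointwise it is at most [delta] on the bounded set
    [Om] plus [c^-1] times the sum of the defects, which integrates to less. *)
Theorem theorem1p1 (R : realType) (n : nat) (n_gt0 : (0 < n)%N)
    (a : 'I_n -> R) (a_gt0 : forall j, 0 < a j)
    (d : 'I_n -> nat) (d_ge5 : forall j, (5 <= d j)%N)
    (A : set 'rV[R]_(\sum_(j < n) d j))
    (mA : lebesgue_measurable A)
    (dA : (0 < upper_banach_density A)%E) :
  exists2 lambda0 : R, 0 < lambda0 &
    forall lambda : R, lambda0 <= lambda ->
      exists x s : forall j : 'I_n, 'rV[R]_(d j),
        (forall j, l2norm (s j) = lambda * a j) /\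
        (forall k : 'I_n -> bool,
           A (\mxrow_(j < n) (x j + (k j)%:R *: s j))).
Proof.
apply: contrapT => contra.
pose D := (\sum_(j < n) d j)%N.
have [delta0 delta0_gt0 hdelta] := upper_banach_density_cube dA.
(* With [(2 * N) ^+ D] as the volume of [Om], the low-density term is at most
   [delta0 * N ^+ D / (2 * 3 ^+ D)], hence at most half of [2 ^- D * vN]. *)
pose delta := delta0 / (2 * 6 ^+ D).
have delta_gt0 : 0 < delta by rewrite divr_gt0// mulr_gt0// exprn_gt0.
have [b [k [Lam [rho1 [J [c [[/andP[b0 b1] k0 Lam1 [rho11 brho1] c0] core]]]]]]] := box_count_large n delta_gt0.
have [lam [lam1 lamS lam0 nobox]] := @lacunary_counterexamples R (has_box a A) Lam Lam1 contra.
pose asum := \sum_i a i.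
have a_le i : a i <= asum.
  by rewrite /asum (bigD1 i)//= lerDl sumr_ge0// => j _; exact: ltW.
pose lamsum := \sum_(j < J) lam j.
have lam_le j : (j < J)%N -> lam j <= lamsum.
  move=> jJ; rewrite /lamsum (bigD1 (Ordinal jJ))//= lerDl sumr_ge0// => i _; exact: ltW.
have asum0 : 0 <= asum by apply: sumr_ge0 => i _; exact: ltW.
have lamsum0 : 0 <= lamsum by apply: sumr_ge0 => i _; exact: ltW.
have las0 : 0 <= lamsum * asum by exact: mulr_ge0.
(* The cube must contain all arcs of the [J] radii in use; the summand 3 covers the thickening and
   the rounding of [N / tau]. *)
have [N [x0 [hN hmu]]] := hdelta (lamsum * asum + 3).
have N0 : 0 < N by lra.
pose B := A `&` box x0 (x0 + const_mx N).
have mB : lebesgue_measurable B.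
  by apply: caratheodory_measurable_setI => //; exact: box_measurable.
have cube_corner (t s : R) : 0 <= t -> 0 <= s -> le_corner (x0 - const_mx t) (x0 + const_mx s).
  by move=> t0 s0 i; rewrite !mxE; lra.
have vol_cube (t s : R) : box_volume (x0 - const_mx t) (x0 + const_mx s) = (t + s) ^+ D.
  rewrite /box_volume (eq_bigr (fun=> t + s)) ?prodr_const ?card_ord//.
  by move=> i _; rewrite !mxE; ring.
have mu_cube (t s : R) : 0 <= t -> 0 <= s ->
    (lebesgue_mu (box (x0 - const_mx t) (x0 + const_mx s)) <= ((t + s) ^+ D)%:E)%E.
  by move=> t0 s0; rewrite -vol_cube; apply: lebesgue_mu_box; exact: cube_corner.
have Boo : (lebesgue_mu B < +oo)%E.
  apply: (@le_lt_trans _ _ ((0 + N) ^+ D)%:E); last exact: ltry.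
  apply: le_trans (mu_cube 0 N (lexx 0) (ltW N0)).
  apply: le_lebesgue_mu => x [_]; rewrite (_ : const_mx 0 = 0) ?subr0//.
pose M := fine (lebesgue_mu B).
have ME : lebesgue_mu B = M%:E by rewrite fineK// ge0_fin_numE// lebesgue_mu_ge0.
have M_ge : delta0 * N ^+ D <= M by rewrite -lee_fin -ME.
pose vN := delta0 * N ^+ D.
have vN0 : 0 < vN by rewrite mulr_gt0// exprn_gt0.
have J0 : 0 < J.+1%:R :> R by rewrite ltr0n.
(* At most [J.+1] defects, each of integral at most [2 ^+ n * eta] and weighted by [c^-1], then sum
   to at most a quarter of [2 ^- D * vN]. *)
pose eta := c * vN / (4 * 2 ^+ D * (2 ^+ n * J.+1%:R)).
have eta0 : 0 < eta by rewrite divr_gt0 ?mulr_gt0 ?exprn_gt0.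
have [r r0 hr] := lebesgue_mu_shift_continuous mB Boo eta0.
pose kk : R := k%:R + 1.
have kk0 : 0 < kk by rewrite /kk ltr_wpDl.
pose amin := (\big[Num.min/1]_(i < n) a i).
have amin0 : 0 < amin.
  by rewrite /amin; elim/big_ind: _ => // u v u0 v0; rewrite lt_min u0.
have amin_le i : amin <= a i by exact: bigmin_le_cond.
(* The rounding error [tau * kk] must be at most [r] and at most 1, and the smallest radius measured
   in mesh units at least [rho1]. *)
pose tau := Num.min (r / kk) (Num.min (kk^-1) (amin / rho1)).
have rho10 : 0 < rho1 by lra.
have tau0 : 0 < tau.
  by rewrite /tau !lt_min invr_gt0 kk0 (divr_gt0 r0 kk0) (divr_gt0 amin0 rho10).
have tau_r : tau * kk <= r by rewrite -ler_pdivlMr// /tau ge_min lexx.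
have tau_k : tau * kk <= 1.
  by rewrite -ler_pdivlMr// div1r /tau !ge_min lexx orbT.
have tau_a i : rho1 <= a i / tau.
  rewrite ler_pdivlMr// mulrC -ler_pdivlMr// (@le_trans _ _ (amin / rho1))//.
    by rewrite /tau !ge_min lexx !orbT.
  by rewrite ler_pM2r ?invr_gt0.
pose Q := Num.trunc (N / tau).
have Ntau0 : 0 <= N / tau by rewrite divr_ge0 ?ltW.
have Q_le : tau * Q%:R <= N.
  by rewrite mulrC -ler_pdivlMr// truncn_le.
have Q_gt : N - tau < tau * Q%:R.
  have := truncnS_gt (N / tau); rewrite -natr1 -/Q ltr_pdivrMr//; lra.
have tau1 : tau <= 1.
  by apply: le_trans tau_k; rewrite ler_peMr ?(ltW tau0)// /kk lerDr.
pose rho i j := lam j * a i / tau.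
have rho0 i j : 0 <= rho i j by rewrite divr_ge0 ?mulr_ge0 ?(ltW (lam0 _)) ?(ltW (a_gt0 _)) ?(ltW tau0).
have rhoE i j : tau * rho i j = lam j * a i.
  by rewrite /rho mulrC mulfVK// gt_eqF.
have rhoQ i j : (j < J)%N -> rho i j + k%:R <= Q%:R.
  move=> jJ; rewrite -(ler_pM2l tau0) mulrDr rhoE.
  have h1 : lam j * a i <= lamsum * asum.
    by apply: ler_pM; rewrite ?(ltW (lam0 _)) ?(ltW (a_gt0 _)) ?lam_le.
  have h2 : tau * k%:R <= 1.
    by apply: le_trans tau_k; rewrite ler_wpM2l ?(ltW tau0)// /kk lerDl.
  lra.
have rhoS i j : Lam * rho i j <= rho i j.+1.
  by rewrite /rho mulrA [Lam * _]mulrA ler_pM2r ?invr_gt0// ler_pM2r.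
have rho_ge0 i : rho1 <= rho i 0%N.
  apply: (le_trans (tau_a i)); rewrite /rho ler_pM2r ?invr_gt0//.
  by rewrite ler_peMl// ltW.
have rho_ge i j : rho1 <= rho i j.
  elim: j => // j IH; apply: (le_trans IH); apply: le_trans (rhoS i j).
  by rewrite ler_peMl.
pose G : finZmodType := 'rV['I_(2 * Q).+2]_D.
pose T (j : nat) (i : 'I_n) : G -> R :=
  circle (axis Q 0 i) (axis Q 1 i) (rho i j) (Num.trunc (b * rho i j)) k.
have /choice[UY hUY] : forall jit : 'I_J * 'I_n * G, exists UY : nat * nat,
    `|arc_height (rho jit.1.2 jit.1.1) UY.2 - UY.1%:R| <= kk /\
    (T jit.1.1 jit.1.2 jit.2 != 0 ->
     [/\ jit.2 = axis Q 0 jit.1.2 *+ UY.1 + axis Q 1 jit.1.2 *+ UY.2, (UY.1 <= Q)%N,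
         (UY.2 <= Q)%N
       & arc_height (rho jit.1.2 jit.1.1) UY.2 ^+ 2 + UY.2%:R ^+ 2 = rho jit.1.2 jit.1.1 ^+ 2]).
  move=> [[j i] t] /=; apply: circle_decode => //; exact: rhoQ.
pose U (j : 'I_J) (i : 'I_n) (t : G) := (UY (j, i, t)).1.
pose Y (j : 'I_J) (i : 'I_n) (t : G) := (UY (j, i, t)).2.
pose arcv (j : 'I_J) (i : 'I_n) (t : G) := arc_height (rho i j) (Y j i t).
have pT (j : 'I_J) i : prob (T j i).
  apply: prob_circle => //; rewrite truncn_gt0 (le_trans brho1)//.
  by rewrite ler_wpM2l ?(ltW b0)//; exact: rho_ge.
pose Def (j : 'I_J) x := wlist [seq T j i | i <- enum 'I_n]
  (fun ts => defect tau B (U j) (arcv j) ts x).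
have le_Def (j : 'I_J) x :
    wcount mean [seq T j i | i <- enum 'I_n] (sample tau B x : G -> R) <= Def j x.
  apply: (@box_count_le_defect R n d Q tau a _ B A (U j) (Y j) (arcv j) (T j) (lam j)
    (fun i => rho i j)) => //.
  - by move=> i; exact: leq_trans (d_ge5 i).
  - by move=> y [].
  - exact: ltW.
  - by move=> i; exact: pT.
  - by move=> i t Tt; have [_ /(_ Tt)[]] := hUY (j, i, t).
have integ_Def (j : 'I_J) : exists B', B' <= 2 ^+ n * eta /\ integ (Def j) B'.
  have [|ts|B' h1 h2] := @integ_wlist R G D [seq T j i | i <- enum 'I_n]
    (fun ts x => defect tau B (U j) (arcv j) ts x) (2 ^+ n * eta).
  - exact: all_prob_map.
  - apply: (@integ_defect R n d Q tau B (U j) (arcv j) ts r kk mB (ltW tau0) (ltW kk0) tau_r).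
    + by move=> i t; have [] := hUY (j, i, t).
    + exact: ltW.
    + exact: hr.
  - by exists B'.
have [BD hBD] := choice integ_Def.
(* Outside [Om] the sampled grid based at [x] misses [B]. *)
pose Om := box (x0 - const_mx N) (x0 + const_mx N).
have Om_le : (lebesgue_mu Om <= ((N + N) ^+ D)%:E)%E by apply: mu_cube; exact: ltW.
have Om_oo : (lebesgue_mu Om < +oo)%E by apply: le_lt_trans Om_le (ltry _).
have iOm := integ_indic (box_measurable (x0 - const_mx N) (x0 + const_mx N)) Om_oo.
have iL := integ_mean_sample Q tau mB Boo.
pose h (o : option 'I_J) (x : 'rV[R]_D) : R := if o is Some j then Def j x else \1_Om x.
pose w (o : option 'I_J) : R := if o is Some j then c^-1 else delta.
pose BB (o : option 'I_J) : R := if o is Some j then BD j else fine (lebesgue_mu Om).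
have ih o : integ (h o) (BB o) by case: o => [j|] //=; exact: (hBD j).2.
have w0 o : 0 <= w o by case: o => [j|] /=; rewrite ltW// invr_gt0.
have iR := integ_sum (index_enum (option 'I_J)) w0 ih.
have Def0 j x : 0 <= Def j x by have [_ []] := hBD j.
have pointwise x : mean (sample tau B x : G -> R) <= \sum_o w o * h o x.
  have unit_s : unitval (sample tau B x : G -> R) by move=> g; exact: sample_itv.
  have wh0 o : 0 <= w o * h o x.
    by rewrite mulr_ge0//; case: o => [j|] /=; rewrite ?Def0// indicE ler0n.
  have [Omx|nOm] := pselect (Om x); last first.
    rewrite [leLHS](_ : _ = 0) ?sumr_ge0//.
    rewrite -(@mean_cst R G 0); apply: eq_mean => g; rewrite /sample.
    case: (boolP (in_cube g)) => [/forallP hg|_]; last by rewrite mul0r.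
    rewrite indicE memNset ?mulr0// => -[_ hB]; apply: nOm => i.
    have := hB i; rewrite !mxE => /andP[h1 h2].
    have h3 : 0 <= tau * (g ord0 i : nat)%:R by rewrite mulr_ge0 ?ler0n ?(ltW tau0).
    have h4 : tau * (g ord0 i : nat)%:R <= N.
      by apply: le_trans Q_le; rewrite ler_wpM2l ?(ltW tau0)// ler_nat hg.
    by apply/andP; split; lra.
  have [hm|hm] := ltrP (mean (sample tau B x : G -> R)) delta.
    apply: (@le_trans _ _ (w None * h None x)).
      by rewrite /= indicE mem_set// mulr1 ltW.
    by rewrite (bigD1 None)//= lerDl sumr_ge0.
  (* The good scale depends on [x], so all [J] defects enter the bound. As the density is at most 1,
     [c <= Def j x] suffices. *)
  have [j jJ hj] := core G (axis Q 0) (axis Q 1) rho (sample tau B x)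
     rho_ge0 rhoS unit_s hm.
  apply: (@le_trans _ _ (w (Some (Ordinal jJ)) * h (Some (Ordinal jJ)) x)).
    rewrite /= -ler_pdivrMl ?invr_gt0// invrK.
    apply: le_trans (le_trans hj (le_Def (Ordinal jJ) x)).
    by rewrite ler_piMr ?(ltW c0)//; case/andP: (unitval_mean unit_s).
  by rewrite (bigD1 (Some (Ordinal jJ)))//= lerDl sumr_ge0.
have final := integ_le iL iR pointwise.
have bJ : \sum_(o | o != None) w o * BB o <= c^-1 * (2 ^+ n * eta) * J.+1%:R.
  apply: (@le_trans _ _ (\sum_(o : option 'I_J | o != None) c^-1 * (2 ^+ n * eta))).
    apply: ler_sum => -[j|] //= _; rewrite ler_pM2l ?invr_gt0//.
    by case: (hBD j).
  rewrite sumr_const -[leLHS]mulr_natr ler_wpM2l//.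
    apply: mulr_ge0; first by rewrite invr_ge0 ltW.
    by apply: mulr_ge0; [exact: exprn_ge0|exact: ltW].
  by rewrite ler_nat (leq_trans (max_card _))// card_option card_ord.
have bOm : fine (lebesgue_mu Om) <= (N + N) ^+ D.
  by rewrite -lee_fin fineK// ge0_fin_numE// lebesgue_mu_ge0.
have bL : 2 ^- D * vN <= mean (fun g : G => (in_cube g)%:R) * fine (lebesgue_mu B).
  apply: ler_pM; [by rewrite invr_ge0 exprn_ge0|exact: ltW|exact: mean_in_cube_ge|].
  exact: M_ge.
have := le_trans bL final; rewrite (bigD1 None)//= leNgt => /negP; apply.
apply: (@le_lt_trans _ _ (delta * (N + N) ^+ D + c^-1 * (2 ^+ n * eta) * J.+1%:R)).
  by apply: lerD => //; rewrite ler_wpM2l// ltW.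
have -> : c^-1 * (2 ^+ n * eta) * J.+1%:R = 2 ^- D * vN / 4.
  rewrite /eta; have := J0; have := exprn_gt0 n (ltr0n R 2); have := exprn_gt0 D (ltr0n R 2).
  move: (2 ^+ n) (2 ^+ D) (J.+1%:R : R) => p q s q0 p0 s0.
  by field; rewrite !gt_eqF.
have h1 : delta * (N + N) ^+ D <= 2 ^- D * vN / 2.
  rewrite /delta /vN (_ : N + N = 2 * N); last by ring.
  have -> : 6 ^+ D = 2 ^+ D * 3 ^+ D :> R by rewrite -exprMn; congr (_ ^+ _); ring.
  rewrite exprMn.
  have p0 := exprn_gt0 D (ltr0n R 2); have q0 := exprn_gt0 D (ltr0n R 3).
  have pq : 2 ^+ D <= 3 ^+ D :> R by rewrite lerXn2r// ?nnegrE// ler_nat.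
  have X0 : 0 <= N ^+ D by rewrite exprn_ge0// ltW.
  move: (2 ^+ D) (3 ^+ D) (N ^+ D) p0 q0 pq X0 => p q X p0 q0 pq X0.
  have -> : delta0 / (2 * (p * q)) * (p * X) = q^-1 * (delta0 * X) / 2.
    by field; rewrite !gt_eqF.
  by rewrite ler_pM2r ?invr_gt0// ler_wpM2r// ?lef_pV2// mulr_ge0// ltW.
have : 0 < 2 ^- D * vN by rewrite mulr_gt0// invr_gt0 exprn_gt0.
lra.
Qed.
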